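(* A sequence $(P_n)_{n\geq 1}$ of probability measures on $\big(\mathbb{D}([0,1];\mathbb{D}),\mathcal{D}_{\mathbb{D}}\big)$ is tight if and only if it satisfies the following three conditions: (i) $\displaystyle\lim_{a \to \infty} \limsup_{n\to \infty} P_n\big(\{x:\ \|x\|_{\mathbb{D}} \geq a\}\big)=0$; (ii') for any $\varepsilon>0$, (a) $\lim_{\delta \to 0}\limsup_{n \to \infty}P_n(\{x:\ w''(x(t),\delta) \geq \varepsilon \text{ for some } t \in [0,1]\})=0$; (b) $\lim_{\delta \to 0}\limsup_{n \to \infty}P_n(\{x:\ |x(t,\delta)-x(t,0)| \geq \varepsilon \text{ for some } t \in [0,1]\})=0$; (c) $\lim_{\delta \to 0}\limsup_{n \to \infty}P_n(\{x:\ |x(t,1-)-x(t,1-\delta)| \geq \varepsilon \text{ for some } t \in [0,1]\})=0$; (iii') for any $\varepsilon>0$, (a) $\lim_{\delta \to 0}\limsup_{n \to \infty}P_n(\{x:\ w_{\mathbb{D}}''(x,\delta) \geq \varepsilon \})=0$; (b) $\lim_{\delta \to 0}\limsup_{n \to \infty}P_n(\{x:\ d_{J_1}^{0}(x(\delta),x(0)) \geq \varepsilon \})=0$; (c) $\lim_{\delta \to 0}\limsup_{n \to \infty}P_n(\{x:\ d_{J_1}^{0}(x(1-),x(1-\delta)) \geq \varepsilon \})=0$.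
   Context: $\mathbb{D}$ is the set of functions $x:[0,1]\to\mathbb{R}$ that are right-continuous and have left limits, with $\|x\|=\sup_{s\in[0,1]}|x(s)|$. $\Lambda$ is the set of strictly increasing continuous functions from $[0,1]$ onto $[0,1]$, $e$ is the identity on $[0,1]$, and for $\lambda\in\Lambda$, $\|\lambda\|^0=\sup_{s<s'}\left|\log\frac{\lambda(s')-\lambda(s)}{s'-s}\right|$. The Skorohod $J_1$-topology on $\mathbb{D}$ is given by the (complete, separable) metric $d_{J_1}^0(x,y)=\inf_{\lambda\in\Lambda}\{\|\lambda\|^0\vee\|x-y\circ\lambda\|\}$. $\mathbb{D}([0,1];\mathbb{D})$ is the set of functions $x:[0,1]\to\mathbb{D}$ that are right-continuous at every $t\in[0,1)$ and have a left limit $x(t-)\in\mathbb{D}$ at every $t\in(0,1]$, both with respect to $d_{J_1}^0$. For $x\in\mathbb{D}([0,1];\mathbb{D})$, write $x(t,s)$ for the value of $x(t)\in\mathbb{D}$ at $s$, and $x(t,1-)=\lim_{s\uparrow 1}x(t,s)$. Put $\|x\|_{\mathbb{D}}=\sup_{t\in[0,1]}\|x(t)\|$. The space is equipped with the metric $d_{\mathbb{D}}(x,y)=\inf_{\lambda\in\Lambda}\{\|\lambda-e\|\vee\rho_{\mathbb{D}}(x,y\circ\lambda)\}$, where $\rho_{\mathbb{D}}(x,y)=\sup_{t\in[0,1]}d_{J_1}^0(x(t),y(t))$, and with its Borel $\sigma$-field $\mathcal{D}_{\mathbb{D}}$ for $d_{\mathbb{D}}$. For $\delta\in(0,1)$: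 for $x\in\mathbb{D}$, $w''(x,\delta)=\sup\{|x(s)-x(s_1)|\wedge|x(s_2)-x(s)|:\ s_1\le s\le s_2,\ s_2-s_1\le\delta\}$; for $x\in\mathbb{D}([0,1];\mathbb{D})$, $w''_{\mathbb{D}}(x,\delta)=\sup\{d_{J_1}^0(x(t),x(t_1))\wedge d_{J_1}^0(x(t_2),x(t)):\ t_1\le t\le t_2,\ t_2-t_1\le\delta\}$ (all points in $[0,1]$). A family of probability measures on $(\mathbb{D}([0,1];\mathbb{D}),\mathcal{D}_{\mathbb{D}})$ is tight if for every $\eta>0$ there is a $d_{\mathbb{D}}$-compact set $K$ with $P(K)\ge 1-\eta$ for every $P$ in the family. *)

(* Defs.v *)
From HB Require Import structures.
From mathcomp Require Import all_boot all_order all_algebra.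
From mathcomp Require Import all_classical all_reals all_analysis.

Set Implicit Arguments.
Unset Strict Implicit.
Unset Printing Implicit Defensive.

Import Order.TTheory GRing.Theory Num.Theory.
Import numFieldNormedType.Exports.

Local Open Scope classical_set_scope.
Local Open Scope ring_scope.

(* The interval [0, 1] as a type, with its subspace topology. *)
Notation I01 R := (set_type (`[0%R, 1%R]%classic : set R)).

Section unit_interval.
Variable R : realType.
Implicit Types (s t : I01 R) (r : R).

Lemma I01_0 : (0 : R) \in (`[0, 1]%classic : set R).
Proof. by rewrite inE /= in_itv /= lexx ler01. Qed.

Lemma I01_1 : (1 : R) \in (`[0, 1]%classic : set R).
Proof. by rewrite inE /= in_itv /= lexx ler01. Qed.

Definition I0 : I01 R := Sub 0 I01_0.
Definition I1 : I01 R := Sub 1 I01_1.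

(* The real r seen as a point of [0, 1]; the value I0 for r outside [0, 1] is
   a placeholder. *)
Definition toI r : I01 R := insubd I0 r.

Definition at_rightI t : set_system (I01 R) :=
  within [set u | val t < val u] (nbhs t).

Definition at_leftI t : set_system (I01 R) :=
  within [set u | val u < val t] (nbhs t).

Definition left_lim (T : ptopologicalType) (x : I01 R -> T) t : T :=
  lim (x @ at_leftI t).

Definition cadlag (T : topologicalType) : set (I01 R -> T) :=
  [set x : I01 R -> T | (forall t, val t < 1 -> x @ at_rightI t --> x t) /\
           (forall t, 0 < val t -> exists l : T, x @ at_leftI t --> l)].

Definition time_change : set (I01 R -> I01 R) :=
  [set l : I01 R -> I01 R | [/\ forall s t, val s < val t -> val (l s) < val (l t),
               continuous l & forall t, exists s, l s = t]].

End unit_interval.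

(* Norms, distances and moduli take values in \bar R, so that every supremum
   below is a genuine one (some are infinite, such as log_norm l for a time
   change l that is not bi-Lipschitz). *)
Section distances.
Variable R : realType.
Implicit Types (l : I01 R -> I01 R) (delta : R).
Local Open Scope ereal_scope.

Definition abs_dist (a b : R) : \bar R := (`|a - b|%R)%:E.

Definition sup_norm (x : I01 R -> R) : \bar R :=
  ereal_sup [set (`|x s|%R)%:E | s in [set: I01 R]].

Definition log_norm l : \bar R :=
  ereal_sup [set e | exists s t, (val s < val t)%R /\
    e = (`|ln ((val (l t) - val (l s)) / (val t - val s))|%R)%:E].

Definition dev_norm l : \bar R := sup_norm (fun s => val (l s) - val s)%R.

Definition unif_dist (T : Type) (d : T -> T -> \bar R) (x y : I01 R -> T) :=
  ereal_sup [set d (x t) (y t) | t in [set: I01 R]].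

Definition skorohod_dist (cost : (I01 R -> I01 R) -> \bar R)
    (T : Type) (d : T -> T -> \bar R) (x y : I01 R -> T) : \bar R :=
  ereal_inf [set maxe (cost l) (unif_dist d x (y \o l)) | l in @time_change R].

Definition modulus2 (T : Type) (d : T -> T -> \bar R) (x : I01 R -> T) delta :
    \bar R :=
  ereal_sup [set e | exists s1 s s2,
    [/\ (val s1 <= val s)%R, (val s <= val s2)%R,
        (val s2 - val s1 <= delta)%R &
        e = mine (d (x s) (x s1)) (d (x s2) (x s))]].

End distances.

Section time_changes.
Variable R : realType.
Implicit Types (l m : I01 R -> I01 R).

Lemma I01_itv (s : I01 R) : 0 <= val s <= 1.
Proof. by have := valP s; rewrite inE /= in_itv. Qed.

Lemma time_change_id : time_change (@id (I01 R)).
Proof.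
split => //; first by move=> x; exact: cvg_id.
by move=> t; exists t.
Qed.

Lemma time_change_comp l m :
  time_change l -> time_change m -> time_change (m \o l).
Proof.
move=> [li lc lr] [mi mc mr]; split.
- by move=> s t /li /mi.
- by move=> x; apply: continuous_comp; [exact: lc|exact: mc].
- by move=> t; have [s <-] := mr t; have [u <-] := lr s; exists u.
Qed.

Lemma nbhs_I01_lt (s v : I01 R) : val s < val v ->
  \forall u \near s, val u < val v.
Proof.
move=> sv; have : \forall r \near (val s : R), r < val v by exact: lt_nbhsl.
exact: (@initial_continuous (I01 R) R val s).
Qed.

Lemma nbhs_I01_gt (s v : I01 R) : val v < val s ->
  \forall u \near s, val v < val u.
Proof.
move=> sv; have : \forall r \near (val s : R), val v < r by exact: lt_nbhsr.
exact: (@initial_continuous (I01 R) R val s).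
Qed.

Lemma I01_between (a : R) : 0 <= a <= 1 -> exists v : I01 R, val v = a.
Proof.
move=> a01; have aI : a \in (`[0, 1]%classic : set R) by rewrite inE /= in_itv.
by exists (Sub a aI).
Qed.

Lemma incr_onto_continuous l :
  (forall s t, val s < val t -> val (l s) < val (l t)) ->
  (forall t, exists s, l s = t) -> continuous (fun u : I01 R => val (l u) : R).
Proof.
move=> li surj s.
have nF : Filter (nbhs s) := nbhs_filter s.
have lt_refl u v : val (l u) < val (l v) -> val u < val v.
  move=> luv; case: (ltgtP (val u) (val v)) => // [/li|/val_inj uv].
    by move=> /lt_trans /(_ luv); rewrite ltxx.
  by move: luv; rewrite uv ltxx.
apply/cvgrPdist_lt => e e0.
have lo : nbhs s [set u | val (l s) - e < val (l u)].
  have [neg|pos] := ltP (val (l s) - e) 0.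
    apply: filterE => u /=; apply: (lt_le_trans neg).
    by case/andP: (I01_itv (l u)).
  have /I01_between[v] : 0 <= val (l s) - e <= 1.
    rewrite pos /= lerBlDr; case/andP: (I01_itv (l s)) => _ /le_trans; apply.
    by rewrite lerDl ltW.
  have [w <-] := surj v => lw; have ws : val w < val s.
    by apply: lt_refl; rewrite lw ltrBlDr ltrDl.
  by rewrite -lw; apply: filterS (nbhs_I01_gt ws) => u /li.
have up : nbhs s [set u | val (l u) < val (l s) + e].
  have [big|small] := ltP 1 (val (l s) + e).
    apply: filterE => u /=; apply: le_lt_trans big.
    by case/andP: (I01_itv (l u)).
  have /I01_between[v] : 0 <= val (l s) + e <= 1.
    rewrite small andbT; case/andP: (I01_itv (l s)) => l0 _.
    by rewrite addr_ge0// ltW.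
  have [w <-] := surj v => lw; have ws : val s < val w.
    by apply: lt_refl; rewrite lw ltrDl.
  by rewrite -lw; apply: filterS (nbhs_I01_lt ws) => u /li.
apply: filterS2 lo up => u /= lo up.
by rewrite distrC ltr_distl lo up.
Qed.

Lemma incr_onto_time_change l :
  (forall s t, val s < val t -> val (l s) < val (l t)) ->
  (forall t, exists s, l s = t) -> time_change l.
Proof.
move=> li surj; split => // s.
exact: (@continuous_comp_initial _ _ _ val l (incr_onto_continuous li surj) s).
Qed.

Lemma time_change_inv l : time_change l ->
  exists2 m, time_change m & cancel l m /\ cancel m l.
Proof.
move=> [li lc surj].
have [m mK] := choice surj.
have lt_refl u v : val (l u) < val (l v) -> val u < val v.
  move=> luv; case: (ltgtP (val u) (val v)) => // [/li|/val_inj uv].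
    by move=> /lt_trans /(_ luv); rewrite ltxx.
  by move: luv; rewrite uv ltxx.
have lK : cancel l m.
  move=> u; apply: val_inj.
  by case: (ltgtP (val (m (l u))) (val u)) => // /li; rewrite mK ltxx.
exists m; last by split.
apply: incr_onto_time_change => [s t st|].
  by apply: lt_refl; rewrite !mK.
by move=> u; exists (l u).
Qed.

End time_changes.

Section distance_theory.
Variable R : realType.
Implicit Types (l m : I01 R -> I01 R).
Local Open Scope ereal_scope.

Lemma sup_norm_ub (x : I01 R -> R) s : (`|x s|%R)%:E <= sup_norm x.
Proof. by apply: ereal_sup_ubound; exists s. Qed.

Lemma log_norm_ub l s t : (val s < val t)%R ->
  (`|ln ((val (l t) - val (l s)) / (val t - val s))|%R)%:E <= log_norm l.
Proof. by move=> st; apply: ereal_sup_ubound; exists s, t. Qed.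

Lemma log_norm_ge0 l : 0 <= log_norm l.
Proof.
have lt01 : (val (I0 R) < val (I1 R))%R by rewrite /= ltr01.
by apply: le_trans (log_norm_ub l lt01); rewrite lee_fin.
Qed.

Lemma dev_norm_ge0 l : 0 <= dev_norm l.
Proof.
by apply: le_trans (sup_norm_ub _ (I0 R)); rewrite lee_fin.
Qed.

Lemma log_norm_id : log_norm (@id (I01 R)) = 0.
Proof.
apply/eqP; rewrite eq_le log_norm_ge0 andbT; apply: ge_ereal_sup => _ [s [t [st ->]]].
by rewrite divff ?ln1 ?normr0// subr_eq0 gt_eqF.
Qed.

Lemma dev_norm_id : dev_norm (@id (I01 R)) = 0.
Proof.
apply/eqP; rewrite eq_le dev_norm_ge0 andbT; apply: ge_ereal_sup => _ [s _ <-].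
by rewrite subrr normr0.
Qed.

Lemma log_norm_comp l m : time_change l -> time_change m ->
  log_norm (m \o l) <= log_norm l + log_norm m.
Proof.
move=> [li _ _] [mi _ _]; apply: ge_ereal_sup => _ [s [t [st ->]]].
have lst := li _ _ st; have mst := mi _ _ lst.
have := leeD (log_norm_ub l st) (log_norm_ub m lst).
apply: le_trans; rewrite -EFinD lee_fin.
have p1 : (0 < val t - val s)%R by rewrite subr_gt0.
have p2 : (0 < val (l t) - val (l s))%R by rewrite subr_gt0.
have p3 : (0 < val (m (l t)) - val (m (l s)))%R by rewrite subr_gt0.
rewrite /= !ln_div ?posrE//.
by rewrite [X in (X <= _)%R](_ : _ = `|(ln (val (l t) - val (l s)) - ln (val t - val s)) +
  (ln (val (m (l t)) - val (m (l s))) - ln (val (l t) - val (l s)))|%R) ?ler_normD//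
  [in RHS]addrC addrA subrK.
Qed.

Lemma dev_norm_comp l m : time_change l -> time_change m ->
  dev_norm (m \o l) <= dev_norm l + dev_norm m.
Proof.
move=> _ _; apply: ge_ereal_sup => _ [s _ <-].
have := leeD (sup_norm_ub (fun s => val (l s) - val s)%R s)
  (sup_norm_ub (fun s => val (m s) - val s)%R (l s)).
apply: le_trans; rewrite -EFinD lee_fin /=.
by rewrite [X in (X <= _)%R](_ : _ = `|(val (l s) - val s) +
  (val (m (l s)) - val (l s))|%R) ?ler_normD// [in RHS]addrC addrA subrK.
Qed.

Lemma log_norm_inv l m : time_change l -> time_change m ->
  cancel m l -> log_norm m <= log_norm l.
Proof.
move=> [li _ _] [mi _ _] mK; apply: ge_ereal_sup => _ [s [t [st ->]]].
have mst := mi _ _ st.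
apply: le_trans (log_norm_ub l mst); rewrite !mK lee_fin.
by rewrite !ln_div ?posrE ?subr_gt0// distrC.
Qed.

Lemma dev_norm_inv l m : time_change l -> time_change m ->
  cancel m l -> dev_norm m <= dev_norm l.
Proof.
move=> _ _ mK; apply: ge_ereal_sup => _ [s _ <-].
apply: le_trans (sup_norm_ub _ (m s)); rewrite mK lee_fin.
by rewrite distrC.
Qed.

Lemma abs_dist_ge0 (a b : R) : 0 <= abs_dist a b.
Proof. by rewrite lee_fin. Qed.

Lemma abs_distxx (a : R) : abs_dist a a = 0.
Proof. by rewrite /abs_dist subrr normr0. Qed.

Lemma abs_distC (a b : R) : abs_dist a b = abs_dist b a.
Proof. by rewrite /abs_dist distrC. Qed.

Lemma abs_dist_triangle (a b c : R) :
  abs_dist a c <= abs_dist a b + abs_dist b c.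
Proof. by rewrite -EFinD lee_fin ler_distD. Qed.

End distance_theory.

Section skorohod_dist_theory.
Variables (R : realType) (cost : (I01 R -> I01 R) -> \bar R).
Variables (T : Type) (d : T -> T -> \bar R).
Local Open Scope ereal_scope.
Hypothesis cost_ge0 : forall l, 0 <= cost l.
Hypothesis cost_id : cost id = 0.
Hypothesis cost_comp : forall l m, time_change l -> time_change m ->
  cost (m \o l) <= cost l + cost m.
Hypothesis cost_inv : forall l m, time_change l -> time_change m ->
  cancel m l -> cost m <= cost l.
Hypothesis dxx : forall a, d a a = 0.
Hypothesis dC : forall a b, d a b = d b a.
Hypothesis dD : forall a b c, d a c <= d a b + d b c.

Lemma skorohod_dist_ge0 x y : 0 <= skorohod_dist cost d x y.
Proof.
by apply: le_ereal_inf_tmp => _ [l _ <-]; rewrite le_max cost_ge0.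
Qed.

Lemma skorohod_distxx x : skorohod_dist cost d x x = 0.
Proof.
apply/eqP; rewrite eq_le skorohod_dist_ge0 andbT.
apply: ge_ereal_inf; exists (maxe (cost id) (unif_dist d x (x \o id))).
  by exists id => //; exact: time_change_id.
rewrite ge_max cost_id lexx /=; apply: ge_ereal_sup => _ [t _ <-].
by rewrite /= dxx.
Qed.

Lemma skorohod_dist_sub x y : skorohod_dist cost d y x <= skorohod_dist cost d x y.
Proof.
apply: le_ereal_inf_tmp => _ [l ltc <-].
have [m mtc [lK mK]] := time_change_inv ltc.
apply: ge_ereal_inf; exists (maxe (cost m) (unif_dist d y (x \o m))).
  by exists m.
rewrite ge_max !le_max (cost_inv ltc mtc mK) /=; apply/orP; right.
apply: ge_ereal_sup => _ [t _ <-]; apply: ereal_sup_ubound; exists (m t) => //=.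
by rewrite mK dC.
Qed.

Lemma skorohod_distC x y : skorohod_dist cost d x y = skorohod_dist cost d y x.
Proof. by apply/eqP; rewrite eq_le !skorohod_dist_sub. Qed.

Lemma skorohod_dist_triangle x y z :
  skorohod_dist cost d x z <= skorohod_dist cost d x y + skorohod_dist cost d y z.
Proof.
rewrite leNgt; apply/negP => lt_z.
have [[xyf yzf]|] := pselect (skorohod_dist cost d x y \is a fin_num /\
    skorohod_dist cost d y z \is a fin_num); last first.
  move=> nf; move: lt_z; rewrite ltNge => /negP; apply.
  have := skorohod_dist_ge0 x y; have := skorohod_dist_ge0 y z; move: nf.
  case: (skorohod_dist cost d x y) => [a| |]; case: (skorohod_dist cost d y z) => [b| |] //=.
  - by case.
  - by move=> *; rewrite leey.
  - by move=> *; rewrite leey.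
  - by move=> *; rewrite leey.
move: lt_z; rewrite ltNge => /negP; apply.
apply/lee_addgt0Pr => e e0; have e20 : (0 < e / 2)%R by rewrite divr_gt0.
have [_ [l ltc <-] lxy] := lb_ereal_inf_adherent e20 xyf.
have [_ [m mtc <-] myz] := lb_ereal_inf_adherent e20 yzf.
rewrite [e]splitr EFinD addeACA.
apply: le_trans (leeD (ltW lxy) (ltW myz)).
apply: ge_ereal_inf; exists (maxe (cost (m \o l)) (unif_dist d x (z \o (m \o l)))).
  by exists (m \o l) => //; exact: time_change_comp.
rewrite ge_max; apply/andP; split.
  by apply: (le_trans (cost_comp ltc mtc)); apply: leeD; rewrite le_max lexx.
apply: ge_ereal_sup => _ [t _ <-] /=.
apply: (le_trans (dD _ (y (l t)) _)); apply: leeD; rewrite le_max; apply/orP; right.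
  by apply: ereal_sup_ubound; exists t.
by apply: ereal_sup_ubound; exists (l t).
Qed.

End skorohod_dist_theory.

Section ball_of_dist.
Variables (R : realType) (T : Type) (d : T -> T -> \bar R).
Local Open Scope ereal_scope.
Hypothesis dxx : forall a, d a a = 0.
Hypothesis dC : forall a b, d a b = d b a.
Hypothesis dD : forall a b c, d a c <= d a b + d b c.

Definition dist_ball (x : T) (e : R) : set T := [set y | d x y < e%:E].

Lemma dist_ball_center x (e : R) : (0 < e)%R -> dist_ball x e x.
Proof. by move=> e0; rewrite /dist_ball /= dxx lte_fin. Qed.

Lemma dist_ball_sym x y (e : R) : dist_ball x e y -> dist_ball y e x.
Proof. by rewrite /dist_ball /= dC. Qed.

Lemma dist_ball_triangle x y z (e1 e2 : R) :
  dist_ball x e1 y -> dist_ball y e2 z -> dist_ball x (e1 + e2)%R z.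
Proof.
rewrite /dist_ball /= => xy yz; apply: (le_lt_trans (dD _ y _)).
by rewrite EFinD lteD.
Qed.

End ball_of_dist.

Lemma cadlag_cst (R : realType) (T : topologicalType) (c : T) :
  @cadlag R T (fun=> c).
Proof.
split => [t _|t _]; first exact: cvg_cst.
by exists c; exact: cvg_cst.
Qed.

Definition skoD (R : realType) : Type := set_type (@cadlag R R).

Definition skoD_fun (R : realType) (x : skoD R) : I01 R -> R := val x.
Coercion skoD_fun : skoD >-> Funclass.

Section J1_metric.
Variable R : realType.

Definition dJ1 (x y : skoD R) : \bar R :=
  skorohod_dist (@log_norm R) (@abs_dist R) x y.

Lemma dJ1_ge0 x y : (0 <= dJ1 x y)%E.
Proof. by apply: skorohod_dist_ge0; exact: log_norm_ge0. Qed.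

Lemma dJ1xx x : dJ1 x x = 0%E.
Proof.
apply: skorohod_distxx; [exact: log_norm_ge0|exact: log_norm_id|].
exact: abs_distxx.
Qed.

Lemma dJ1C x y : dJ1 x y = dJ1 y x.
Proof.
by apply: skorohod_distC; [exact: log_norm_inv|exact: abs_distC].
Qed.

Lemma dJ1_triangle x y z : (dJ1 x z <= dJ1 x y + dJ1 y z)%E.
Proof.
apply: skorohod_dist_triangle; [exact: log_norm_ge0|exact: log_norm_comp|].
exact: abs_dist_triangle.
Qed.

Definition w2 (x : skoD R) (delta : R) : \bar R :=
  modulus2 (@abs_dist R) x delta.

HB.instance Definition _ := Choice.on (skoD R).

HB.instance Definition _ := isPointed.Build (skoD R)
  (exist _ (fun=> 0) (mem_set (cadlag_cst R (0 : R))) : skoD R).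

HB.instance Definition _ := hasNbhs.Build (skoD R)
  (nbhs_ (entourage_ (dist_ball dJ1))).

HB.instance Definition _ := @Nbhs_isPseudoMetric.Build R (skoD R)
  (entourage_ (dist_ball dJ1)) erefl (dist_ball dJ1)
  (dist_ball_center dJ1xx) (dist_ball_sym dJ1C)
  (dist_ball_triangle dJ1_triangle) erefl.

End J1_metric.

Definition skoDD (R : realType) : Type := set_type (@cadlag R (skoD R)).

Definition skoDD_fun (R : realType) (x : skoDD R) : I01 R -> skoD R := val x.
Coercion skoDD_fun : skoDD >-> Funclass.

Section DD_metric.
Variable R : realType.

Definition dDD (x y : skoDD R) : \bar R :=
  skorohod_dist (@dev_norm R) (@dJ1 R) x y.

Lemma dDD_ge0 x y : (0 <= dDD x y)%E.
Proof. by apply: skorohod_dist_ge0; exact: dev_norm_ge0. Qed.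

Lemma dDDxx x : dDD x x = 0%E.
Proof.
apply: skorohod_distxx; [exact: dev_norm_ge0|exact: dev_norm_id|].
exact: dJ1xx.
Qed.

Lemma dDDC x y : dDD x y = dDD y x.
Proof. by apply: skorohod_distC; [exact: dev_norm_inv|exact: dJ1C]. Qed.

Lemma dDD_triangle x y z : (dDD x z <= dDD x y + dDD y z)%E.
Proof.
apply: skorohod_dist_triangle; [exact: dev_norm_ge0|exact: dev_norm_comp|].
exact: dJ1_triangle.
Qed.

HB.instance Definition _ := Choice.on (skoDD R).

HB.instance Definition _ := isPointed.Build (skoDD R)
  (exist _ (fun=> point) (mem_set (cadlag_cst R (point : skoD R))) : skoDD R).

HB.instance Definition _ := hasNbhs.Build (skoDD R)
  (nbhs_ (entourage_ (dist_ball dDD))).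

HB.instance Definition _ := @Nbhs_isPseudoMetric.Build R (skoDD R)
  (entourage_ (dist_ball dDD)) erefl (dist_ball dDD)
  (dist_ball_center dDDxx) (dist_ball_sym dDDC)
  (dist_ball_triangle dDD_triangle) erefl.

Definition w2DD (x : skoDD R) (delta : R) : \bar R :=
  modulus2 (@dJ1 R) x delta.

Definition DD_norm (x : skoDD R) : \bar R :=
  ereal_sup [set sup_norm (x t) | t in [set: I01 R]].

End DD_metric.

Notation borelDD R := (g_sigma_algebraType (@open (skoDD R))).

Definition tight (R : realType) (F : set (probability (borelDD R) R)) : Prop :=
  forall eta : R, 0 < eta ->
  exists2 K : set (skoDD R), compact K &
    forall P, F P -> ((1 - eta)%:E <= P K)%E.

(* The probability of an event is read as its outer measure, because an event
   quantified over an uncountable set of times need not be Borel; on Borel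
   events the two agree (measurable_mu_extE). *)
Definition Pr (R : realType) (P : probability (borelDD R) R)
  (A : set (skoDD R)) : \bar R := mu_ext P A.

(* Main.v *)
Require Import Defs.
From mathcomp Require Import all_boot all_order all_algebra.
From mathcomp Require Import all_classical all_reals all_analysis.
From mathcomp Require Import lra.

(** Everything rests on one compactness criterion, used twice: for paths with
    values in the real line, and for paths with values in the space of such paths.
    Say that a path x is tame at level e and scale delta when, in every triple
    s1 <= s <= s2 with s2 - s1 <= delta, the middle value is e-close to one of the
    other two, and x moves by at most e just after 0 and just before 1. The
    criterion ([compact_closure_tame]) is that a set of paths with values in a
    compact set K, whose tameness scales can be chosen uniformly at each level e,
    has compact closure.

    The reason is that a tame path is determined up to O(e) by finitely many data. A
    window of length delta contains at most one jump of size more than 2e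
    ([tame_break]), so on a grid of mesh 1/N <= delta/3 only some isolated cells
    contain a break point, and up to 4e the path is known from the set of these cells,
    the break points, and the values at the grid points and at the break points. These
    data range over compact sets. Two paths with nearly equal data are close in the
    Skorohod distance with the logarithmic cost: a piecewise linear time change carries
    the breaks of one to those of the other ([tame_match]). Hence an ultrafilter on the
    set of paths is Cauchy for that distance, and it converges because infinite
    compositions of summably small time changes converge ([skorohod_complete],
    [tame_ultra_cvg]). A limit for the logarithmic cost is also one for the uniform
    cost of the outer space.

    Conversely each path is tame at every level for some scale, and this scale serves
    for a whole neighbourhood of the path ([locally_tame]); a property that holds
    locally for the values of a path holds for all values of the nearby paths as well
    ([locally_path]), as the values stay near a compact set. A property of this kind,
    locally true for all small parameters, holds uniformly on compact sets, which gives
    the necessity of the conditions: a compact set is closed because the outer space is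
    Hausdorff ([skoDD_hausdorff]), hence its complement is a Borel event. The same local
    property shows that under a single probability measure the bad events have small
    outer measure for small parameters ([Pr_eventually]), so the upper limits over n in
    the conditions can be replaced by suprema ([Pr_uniformly]); then a countable
    intersection of tame and bounded sets has probability close to 1 under every P n,
    and its closure is compact. *)

Set Implicit Arguments.
Unset Strict Implicit.
Unset Printing Implicit Defensive.

Import Order.TTheory GRing.Theory Num.Theory.
Import numFieldNormedType.Exports.

Local Open Scope classical_set_scope.
Local Open Scope ring_scope.

(** * The unit interval and its time changes *)

Section unit_interval.
Variable R : realType.
Implicit Types (s t u : I01 R) (l : I01 R -> I01 R).

Lemma I01_ge0 t : 0 <= val t.
Proof. by case/andP: (I01_itv t). Qed.

Lemma I01_le1 t : val t <= 1.
Proof. by case/andP: (I01_itv t). Qed.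

Lemma val_I0 : val (I0 R) = 0. Proof. by []. Qed.

Lemma val_I1 : val (I1 R) = 1. Proof. by []. Qed.

Lemma toIK (r : R) : 0 <= r <= 1 -> val (toI r : I01 R) = r.
Proof. by move=> r01; rewrite /toI insubdK// inE /= in_itv. Qed.

Lemma toI_val t : toI (val t) = t.
Proof. exact: valKd. Qed.

Lemma nbhs_I01P t (A : set (I01 R)) :
  nbhs t A <-> exists2 e : R, 0 < e & forall u, `|val u - val t| < e -> A u.
Proof.
split.
  move=> /nbhs_ballP[e /= e0 teA]; exists e => // u ut; apply: teA.
  by rewrite -initial_ballE /= /ball /= distrC.
move=> [e e0 teA]; apply/nbhs_ballP; exists e => // u.
by rewrite -initial_ballE /= /ball /= distrC => /teA.
Qed.

Lemma at_rightIP t (A : set (I01 R)) :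
  at_rightI t A <->
  exists2 e : R, 0 < e & forall u, val t < val u -> val u < val t + e -> A u.
Proof.
split.
  move=> /nbhs_I01P[e e0 teA]; exists e => // u tu ute; apply: teA => //.
  by rewrite ger0_norm; lra.
move=> [e e0 teA]; apply/nbhs_I01P; exists e => // u.
by rewrite ltr_distl => /andP[_ ute] tu; exact: teA.
Qed.

Lemma at_leftIP t (A : set (I01 R)) :
  at_leftI t A <->
  exists2 e : R, 0 < e & forall u, val t - e < val u -> val u < val t -> A u.
Proof.
split.
  move=> /nbhs_I01P[e e0 teA]; exists e => // u tu ut; apply: teA => //.
  by rewrite ltr_distl; lra.
move=> [e e0 teA]; apply/nbhs_I01P; exists e => // u.
by rewrite ltr_distl => /andP[ute _] tu; exact: teA.
Qed.

Lemma compact_I01 : compact [set: I01 R].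
Proof.
apply/compact_near_coveringP => I F P FF cov.
have /compact_near_coveringP seg := @segment_compact R 0 1.
have : F [set i | `[0, 1]%classic `<=` (fun r : R => P i (toI r))].
  apply: ((near_covering_withinP _).2 seg) => r /= r01.
  have r01' : 0 <= r <= 1 by move: r01; rewrite in_itv.
  have [[A B] [/= /nbhs_I01P[e e0 rA] FB] AB] := cov (toI r) Logic.I.
  exists (ball r e, B) => /=; first by split => //; exact: nbhsx_ballx.
  move=> [s i] /= [rs Bi]; rewrite in_itv /= => s01.
  apply: (AB (toI s, i)) => //; split => //; apply: rA.
  by rewrite !toIK// distrC.
apply: filterS => i PB t _.
by have := PB (val t); rewrite toI_val /=; apply; rewrite in_itv /= I01_itv.
Qed.

Lemma time_change_lt l s t : time_change l ->
  (val (l s) < val (l t)) = (val s < val t).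
Proof.
move=> [li _ _]; case: (ltgtP (val s) (val t)) => [/li|/li|/val_inj ->] //.
  by move/ltW; rewrite leNgt => /negbTE.
Qed.

Lemma time_change_le l s t : time_change l ->
  (val (l s) <= val (l t)) = (val s <= val t).
Proof. by move=> tl; rewrite !leNgt time_change_lt. Qed.

Lemma time_change0 l : time_change l -> l (I0 R) = I0 R.
Proof.
move=> tl; have [_ _ /(_ (I0 R))[s s0]] := tl.
have : val (l (I0 R)) <= val (l s) by rewrite time_change_le// I01_ge0.
by rewrite s0 => l0; apply: val_inj; apply/le_anti; rewrite l0 I01_ge0.
Qed.

Lemma time_change1 l : time_change l -> l (I1 R) = I1 R.
Proof.
move=> tl; have [_ _ /(_ (I1 R))[s s1]] := tl.
have : val (l s) <= val (l (I1 R)) by rewrite time_change_le// I01_le1.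
by rewrite s1 => l1; apply: val_inj; apply/le_anti; rewrite l1 I01_le1.
Qed.

Lemma dev_norm_leP l (e : R) : (dev_norm l <= e%:E)%E <->
  forall t, `|val (l t) - val t| <= e.
Proof.
split=> [le_e t|le_e].
  by rewrite -lee_fin; apply: le_trans le_e; exact: (sup_norm_ub (fun s => val (l s) - val s)).
by apply: ge_ereal_sup => _ [t _ <-]; rewrite lee_fin.
Qed.

(** Two-sided bounds on increments pass to pointwise limits, where the time
    change itself is not yet known to be one. *)
Lemma log_norm_leP l (c : R) : (forall s t, val s < val t -> val (l s) < val (l t)) ->
  (log_norm l <= c%:E)%E <-> forall s t, val s < val t ->
    expR (- c) * (val t - val s) <= val (l t) - val (l s) <= expR c * (val t - val s).
Proof.
move=> li.
have E s t : val s < val t ->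
    (`|ln ((val (l t) - val (l s)) / (val t - val s))| <= c) =
    (expR (- c) * (val t - val s) <= val (l t) - val (l s) <= expR c * (val t - val s)).
  move=> st; have ts : 0 < val t - val s by rewrite subr_gt0.
  have lts : 0 < val (l t) - val (l s) by rewrite subr_gt0 li.
  have q0 : 0 < (val (l t) - val (l s)) / (val t - val s) by exact: divr_gt0.
  rewrite ler_norml -(ler_pdivlMr _ _ ts) -(ler_pdivrMr _ _ ts).
  by rewrite -[in RHS](lnK q0) !ler_expR.
split=> [le_c s t st|bnd].
  by rewrite -E// -lee_fin; apply: le_trans le_c; exact: log_norm_ub.
by apply: ge_ereal_sup => _ [s [t [st ->]]]; rewrite lee_fin E//; exact: bnd.
Qed.

Lemma le_expRN1 (c : R) : 1 - expR (- c) <= expR c - 1.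
Proof. by have := expR_ge1Dx (- c); have := expR_ge1Dx c; lra. Qed.

Lemma dev_norm_log_norm l (c : R) : time_change l -> (log_norm l <= c%:E)%E ->
  (dev_norm l <= (expR c - 1)%:E)%E.
Proof.
move=> tl lc; have c0 : 0 <= c by rewrite -lee_fin (le_trans _ lc)// log_norm_ge0.
have E1 : 1 <= expR c by rewrite -expR0 ler_expR.
have [li _ _] := tl; move/(log_norm_leP _ li) : lc => lc.
apply/dev_norm_leP => t; have [t0|t0] := eqVneq (val t) 0.
  have -> : t = I0 R by apply: val_inj.
  by rewrite time_change0// subrr normr0 subr_ge0.
have /lc : val (I0 R) < val t by rewrite val_I0 lt_neqAle eq_sym t0 I01_ge0.
rewrite time_change0// val_I0 !subr0 ler_norml => /andP[lo up].
have N1 := le_expRN1 c; have t_ge0 := I01_ge0 t; have t1 := I01_le1 t.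
have : (expR c - 1) * val t <= expR c - 1 by rewrite ler_piMr// subr_ge0.
have : (1 - expR (- c)) * val t <= (expR c - 1) * val t by rewrite ler_wpM2r.
rewrite !mulrBl !mul1r => h1 h2.
by apply/andP; split; lra.
Qed.

(** The lower bound makes g increasing, the upper one Lipschitz, so that g is
    onto by the intermediate value theorem. *)
Lemma time_changeP (g : R -> R) (c : R) : g 0 = 0 -> g 1 = 1 ->
  (forall r s : R, 0 <= r -> r < s -> s <= 1 ->
    expR (- c) * (s - r) <= g s - g r <= expR c * (s - r)) ->
  exists l, [/\ time_change l, (log_norm l <= c%:E)%E & forall t, val (l t) = g (val t)].
Proof.
move=> g0 g1 gb.
have gi (r s : R) : 0 <= r -> r < s -> s <= 1 -> g r < g s.
  move=> r0 rs s1; have /andP[+ _] := gb r s r0 rs s1.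
  have := expR_gt0 (- c); nra.
have gle (r s : R) : 0 <= r -> r <= s -> s <= 1 -> g r <= g s.
  by move=> r0; rewrite le_eqVlt => /orP[/eqP ->//|rs s1]; exact/ltW/gi.
have g01 (r : R) : 0 <= r <= 1 -> 0 <= g r <= 1.
  by move=> /andP[r0 r1]; rewrite -{1}g0 -g1 !gle.
pose l (t : I01 R) : I01 R := toI (g (val t)).
have lE t : val (l t) = g (val t) by rewrite /l toIK// g01// I01_itv.
have li s t : val s < val t -> val (l s) < val (l t).
  by move=> st; rewrite !lE gi ?I01_ge0 ?I01_le1.
exists l; split => //; last first.
  by apply/log_norm_leP => // s t st; rewrite !lE; apply: gb; rewrite ?I01_ge0 ?I01_le1.
apply: incr_onto_time_change => // v.
(* Outside the unit interval g is frozen, so that it is continuous on the line. *)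
pose cl (r : R) := Num.max 0 (Num.min 1 r).
have cl01 r : 0 <= cl r <= 1.
  by rewrite /cl le_max lexx ge_max ler01 ge_min lexx.
have cl_id r : 0 <= r <= 1 -> cl r = r.
  by move=> /andP[r0 r1]; rewrite /cl (min_idPr r1) (max_idPr r0).
have cl_lip (r s : R) : r <= s -> 0 <= cl s - cl r <= s - r.
  have m1 : Num.max 0 1 = 1 :> R by exact: max_r.
  rewrite /cl => rs; case: (leP 1 r) => r1; case: (leP 1 s) => s1; rewrite ?m1;
  by case: (leP 0 r) => r0; case: (leP 0 s) => s0; apply/andP; split; lra.
have gcl (r s : R) : r <= s -> `|g (cl s) - g (cl r)| <= expR c * (s - r).
  move=> rs; have /andP[h1 h2] := cl_lip _ _ rs.
  have /andP[r0 r1] := cl01 r; have /andP[s0 s1] := cl01 s.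
  have ec := expR_gt0 c.
  have [->|ne] := eqVneq (cl s) (cl r); first by rewrite subrr normr0; nra.
  have rs' : cl r < cl s by rewrite lt_neqAle eq_sym ne; lra.
  have /andP[_ up] := gb _ _ r0 rs' s1.
  by rewrite ger0_norm ?subr_ge0 ?gle//; nra.
have gc : continuous (g \o cl : R -> R).
  move=> r; apply/cvgrPdist_lt => e e0; have ec := expR_gt0 c.
  have q0 : 0 < e / expR c by rewrite divr_gt0.
  near=> s.
  have rs : `|r - s| < e / expR c.
    by near: s; exact: (nbhsx_ballx r _ q0).
  rewrite /=; apply: (@le_lt_trans _ _ (expR c * `|r - s|)).
    case: (leP r s) => rs'; last first.
      by apply: (le_trans (gcl _ _ (ltW rs'))); rewrite ger0_norm; lra.
    rewrite distrC; apply: (le_trans (gcl _ _ rs')).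
    by rewrite distrC ger0_norm; lra.
  by rewrite mulrC -ltr_pdivlMr.
have [||r r01 rv] := @IVT R (g \o cl) 0 1 (val v) ler01.
- exact: continuous_subspaceT.
- by rewrite /= !cl_id ?lexx ?ler01// g0 g1 ge_min le_max I01_ge0 I01_le1 orbT.
move: r01; rewrite in_itv /= => r01.
by exists (toI r); apply: val_inj; rewrite lE toIK// -rv /= cl_id.
Unshelve. all: by end_near. Qed.

End unit_interval.

(** * Distances and tame paths *)

(** The Skorohod distances take values in the extended reals, so they are not
    the metric of a metric structure but only induce its balls. A gauge is such a
    distance; it lets the real line and the inner path space play the same role. *)
Record gauge (R : realType) (T : pseudoMetricType R) := Gauge {
  gdist :> T -> T -> \bar R;
  gdistxx : forall a, gdist a a = 0%E;
  gdistC : forall a b, gdist a b = gdist b a;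
  gdistD : forall a b c, (gdist a c <= gdist a b + gdist b c)%E;
  ball_gdist : forall a (e : R), ball a e = dist_ball gdist a e }.

Section gauge_theory.
Variables (R : realType) (T : pseudoMetricType R) (d : gauge T).
Implicit Types (x y : I01 R -> T) (e r : R) (t u v : I01 R).

Lemma le_gdistD a b c e r :
  (d a b <= e%:E -> d b c <= r%:E -> d a c <= (e + r)%:E)%E.
Proof. move=> ab bc; apply: (le_trans (gdistD d a b c)); by rewrite EFinD leeD. Qed.

Lemma le_gdistC a b e : (d a b <= e%:E -> d b a <= e%:E)%E.
Proof. by rewrite gdistC. Qed.

Lemma le_gdistW a b e r : e <= r -> (d a b <= e%:E -> d a b <= r%:E)%E.
Proof. by move=> er /le_trans; apply; rewrite lee_fin. Qed.

Lemma skorohod_dist_ltP cost x y r : (skorohod_dist cost d x y < r%:E)%E ->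
  exists l, [/\ time_change l, (cost l <= r%:E)%E & forall t, (d (x t) (y (l t)) <= r%:E)%E].
Proof.
move=> /ereal_inf_lt[_ [l tl <-]]; rewrite gt_max => /andP[cl ul].
exists l; split => // [|t]; first exact: ltW.
apply: le_trans (ltW ul); apply: ereal_sup_ubound; by exists t.
Qed.

Lemma skorohod_dist_le cost x y l r : time_change l -> (cost l <= r%:E)%E ->
  (forall t, (d (x t) (y (l t)) <= r%:E)%E) -> (skorohod_dist cost d x y <= r%:E)%E.
Proof.
move=> tl cl dl; apply: ge_ereal_inf; exists (maxe (cost l) (unif_dist d x (y \o l))).
  by exists l.
by rewrite ge_max cl /=; apply: ge_ereal_sup => _ [t _ <-]; exact: dl.
Qed.

Lemma cadlag_right x t e : cadlag x -> val t < 1 -> 0 < e ->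
  exists2 r, 0 < r & forall u, val t <= val u -> val u < val t + r ->
    (d (x t) (x u) <= e%:E)%E.
Proof.
move=> [xr _] t1 e0; have /at_rightIP[r r0 tr] : at_rightI t (x @^-1` ball (x t) e).
  by apply: xr => //; exact: nbhsx_ballx.
exists r => // u; rewrite le_eqVlt => /orP[/eqP/val_inj <- _|tu ur].
  by rewrite gdistxx lee_fin ltW.
by have := tr _ tu ur; rewrite /= (ball_gdist d) /dist_ball /= => /ltW.
Qed.

Lemma cadlag_left x t : cadlag x -> 0 < val t ->
  exists p, forall e, 0 < e -> exists2 r, 0 < r &
    forall u, val t - r < val u -> val u < val t -> (d p (x u) <= e%:E)%E.
Proof.
move=> [_ xl] t0; have [p xp] := xl t t0; exists p => e e0.
have /at_leftIP[r r0 tr] : at_leftI t (x @^-1` ball p e).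
  by apply: xp; exact: nbhsx_ballx.
exists r => // u tu ut; have := tr _ tu ut.
by rewrite /= (ball_gdist d) /dist_ball /= => /ltW.
Qed.

(** The three oscillation conditions of the theorem at once. Close to 0 and
    to 1 all times at distance at most delta are compared and not only the times
    delta and 1 - delta, which makes the condition monotone in delta; comparing the
    values before 1 with each other avoids the left limit at 1. *)
Definition tame e (delta : R) x := [/\
  forall s1 s s2 : I01 R, val s1 <= val s -> val s <= val s2 -> val s2 - val s1 <= delta ->
    (d (x s) (x s1) <= e%:E)%E \/ (d (x s2) (x s) <= e%:E)%E,
  forall s : I01 R, val s <= delta -> (d (x s) (x (I0 R)) <= e%:E)%E &
  forall s s' : I01 R, 1 - delta <= val s -> val s < 1 -> 1 - delta <= val s' -> val s' < 1 ->
    (d (x s) (x s') <= e%:E)%E].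

End gauge_theory.

(** Let sigma be the first time at which x leaves the 2e-ball around x a. By
    right-continuity x sigma is more than e away from x a, so for a later time u the
    triple a, sigma, u forces x u to be e-close to x sigma: a short window has at most
    one large jump. *)
Lemma tame_break (R : realType) (T : pseudoMetricType R) (d : gauge T) (x : I01 R -> T)
    (e delta a b : R) :
  cadlag x -> 0 < e -> tame d e delta x ->
  0 <= a -> a < b -> b <= 1 -> b - a <= delta ->
  exists sigma, [/\ a <= sigma <= b,
    forall u : I01 R, a <= val u -> val u < sigma -> (d (x u) (x (toI a)) <= (2 * e)%:E)%E &
    forall u : I01 R, sigma <= val u -> val u < b -> (d (x u) (x (toI sigma)) <= e%:E)%E].
Proof.
move=> cx e0 [x3 _ _] a0 ab b1 ba.
pose S := [set r : R | exists u : I01 R, [/\ val u = r, a <= r, r < b &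
  ~ (d (x u) (x (toI a)) <= (2 * e)%:E)%E]].
have aK : val (toI a : I01 R) = a by rewrite toIK; lra.
have [S0|S0] := pselect (S !=set0); last first.
  exists b; split; [lra| |by move=> u /le_lt_trans /[apply]; rewrite ltxx].
  move=> u au ub; apply: contrapT => nd; apply: S0; exists (val u).
  by exists u.
have Slb : lbound S a by move=> r [u [_ + _ _]].
have hS : has_inf S by split => //; exists a.
have aS : a <= inf S by apply: lb_le_inf.
have Sge (u : I01 R) : a <= val u -> val u < b -> ~ (d (x u) (x (toI a)) <= (2 * e)%:E)%E ->
    inf S <= val u.
  move=> au ub nd; have lS : has_lbound S by exists a.
  by apply: (ge_inf lS); exists u.
have Sb : inf S < b.
  by have [_ [u [<- ar rb nd]]] := S0; exact: le_lt_trans (Sge _ ar rb nd) rb.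
have sK : val (toI (inf S) : I01 R) = inf S.
  by rewrite toIK//; apply/andP; split; move: a0 aS Sb b1; clear; lra.
exists (inf S); split; first by rewrite aS ltW.
  move=> u au us; apply: contrapT => nd.
  move: (us); rewrite ltNge => /negP; apply.
  by apply: Sge => //; exact: lt_trans us Sb.
have [|r r0 xr] := cadlag_right d (t := toI (inf S)) cx _ e0.
  by rewrite sK; exact: lt_le_trans Sb b1.
have [_ [v [<- av vb nv]] vr] := inf_adherent r0 hS.
have sv : inf S <= val v by apply: Sge.
have ns : ~ (d (x (toI (inf S))) (x (toI a)) <= e%:E)%E.
  move=> sa; apply: nv; apply: (@le_gdistW _ _ _ _ _ (e + e)); first by rewrite mulr_natl.
  by apply: le_gdistD sa; apply: le_gdistC; apply: xr; rewrite sK//.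
move=> u su ub; have [||||//] := x3 (toI a) (toI (inf S)) u; rewrite ?aK ?sK//.
by move: ub ba; clear; lra.
Qed.

Section grid_points.
Variables (R : realType) (N : nat).
Hypothesis N0 : (0 < N)%N.

Definition gridpt (j : nat) : R := j%:R / N%:R.

Lemma gridptS j : gridpt j.+1 = gridpt j + N%:R^-1.
Proof. by rewrite /gridpt -addn1 natrD mulrDl mul1r. Qed.

Lemma gridpt_le i j : (i <= j)%N -> gridpt i <= gridpt j.
Proof. by move=> ij; rewrite ler_wpM2r ?ler_nat// invr_ge0 ler0n. Qed.

Lemma gridpt0 : gridpt 0 = 0. Proof. by rewrite /gridpt mul0r. Qed.

Lemma gridptN : gridpt N = 1.
Proof. by rewrite /gridpt divff// pnatr_eq0 -lt0n. Qed.

Lemma gridpt_itv j : (j <= N)%N -> 0 <= gridpt j <= 1.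
Proof. by move=> jN; rewrite -{1}gridpt0 -gridptN !gridpt_le. Qed.

Lemma gridptK j : (j <= N)%N -> val (toI (gridpt j) : I01 R) = gridpt j.
Proof. by move=> jN; rewrite toIK// gridpt_itv. Qed.

End grid_points.

Section breaks.
Variables (R : realType) (T : pseudoMetricType R) (d : gauge T) (N : nat) (e : R).
Implicit Types (x : I01 R -> T) (u : I01 R).
Local Notation q := (@gridpt R N).

(** Two values on the same side of a break are at most 4e apart, so a cell
    that is not steady has a break in its interior. *)
Definition steady x j := forall u, q j <= val u -> val u < q j.+1 ->
  (d (x u) (x (toI (q j))) <= (4 * e)%:E)%E.

(** For each cell j.+1 that is not steady, s (j.+1) is a break in that cell,
    for the window made of this cell and its two neighbours. Since such cells are at
    least three apart, these windows do not overlap and their breaks can be moved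
    independently. *)
Definition breaks x (s : nat -> I01 R) := [/\ steady x 0,
  forall j, (j.+1 < N)%N -> ~ steady x j.+1 ->
    [/\ (j.+2 < N)%N, q j.+1 <= val (s j.+1) < q j.+2,
    forall u, q j <= val u -> val u < val (s j.+1) -> (d (x u) (x (toI (q j))) <= (2 * e)%:E)%E &
    forall u, val (s j.+1) <= val u -> val u < q j.+3 -> (d (x u) (x (s j.+1)) <= e%:E)%E] &
  forall i j, (i < j)%N -> (j < N)%N -> ~ steady x i -> ~ steady x j -> (i + 3 <= j)%N].

End breaks.

(** A window of three cells has a single break, and a cell that lies on one
    side of it is steady; so among three consecutive cells at most one is not
    steady. *)
Lemma tame_breaks (R : realType) (T : pseudoMetricType R) (d : gauge T) (N : nat)
    (e delta : R) (x : I01 R -> T) :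
  (0 < N)%N -> 0 < e -> cadlag x -> tame d e delta x -> 3 / N%:R <= delta ->
  exists s, breaks d N e x s.
Proof.
move=> N0 e_gt0 cx tx hd; set h : R := N%:R^-1 in hd.
have h_gt0 : 0 < h by rewrite invr_gt0 ltr0n.
have qS j : gridpt R N j.+1 = gridpt R N j + h := gridptS R N j.
have q_le i j : (i <= j)%N -> gridpt R N i <= gridpt R N j := @gridpt_le R N i j.
have q0 : gridpt R N 0 = 0 := gridpt0 R N.
have qN : gridpt R N N = 1 := gridptN R N0.
have qK j : (j <= N)%N -> val (toI (gridpt R N j) : I01 R) = gridpt R N j := @gridptK R N N0 j.
have le2 (u v : I01 R) p : (d (x u) p <= (2 * e)%:E)%E -> (d (x v) p <= (2 * e)%:E)%E ->
    (d (x u) (x v) <= (4 * e)%:E)%E.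
  by move=> /le_gdistD up /le_gdistC /up; apply: le_gdistW; lra.
have le1 (u v : I01 R) p : (d (x u) p <= e%:E)%E -> (d (x v) p <= e%:E)%E ->
    (d (x u) (x v) <= (4 * e)%:E)%E.
  by move=> /le_gdistD up /le_gdistC /up; apply: le_gdistW; lra.
have st0 : steady d N e x 0.
  move=> u _; rewrite qS q0 add0r => uh; have -> : toI 0 = I0 R.
    by apply: val_inj; rewrite toIK// lexx ler01.
  by apply: (@le_gdistW _ _ _ _ _ e); [lra|case: tx => _ + _; apply; lra].
have stN j : j.+1 = N -> steady d N e x j.
  move=> jN u ju uj; rewrite jN qN in uj; have jN' : (j <= N)%N by rewrite -jN.
  have jE : 1 = gridpt R N j + h by have := qS j; rewrite jN qN.
  apply: (@le_gdistW _ _ _ _ _ e); first lra.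
  by case: tx => _ _; apply; rewrite ?(qK _ jN'); lra.
have brk j : (j.+1 < N)%N -> ~ steady d N e x j.+1 -> exists r : I01 R,
    [/\ (j.+2 < N)%N, gridpt R N j.+1 <= val r < gridpt R N j.+2,
    forall u : I01 R, gridpt R N j <= val u -> val u < val r ->
      (d (x u) (x (toI (gridpt R N j))) <= (2 * e)%:E)%E &
    forall u : I01 R, val r <= val u -> val u < gridpt R N j.+3 -> (d (x u) (x r) <= e%:E)%E].
  move=> jN nst.
  have jN' : (j.+2 < N)%N.
    by rewrite ltn_neqAle jN andbT; apply/eqP => /stN.
  have j3 : gridpt R N j.+3 <= 1 by rewrite -qN q_le.
  have j0 : 0 <= gridpt R N j by rewrite -q0 q_le.
  have [||||r [/andP[jr rj] r1 r2]] :=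
    @tame_break R T d x e delta (gridpt R N j) (gridpt R N j.+3) cx e_gt0 tx.
  - by [].
  - by rewrite !qS; lra.
  - by [].
  - by rewrite !qS; lra.
  have jN1 := ltnW jN.
  have rK : val (toI r : I01 R) = r.
    by rewrite toIK//; apply/andP; split; move: j0 jr rj j3; clear; lra.
  exists (toI r); rewrite rK; split => //; apply/andP; split.
    rewrite leNgt; apply/negP => rlt; apply: nst => u ju uj.
    apply: (le1 _ _ (x (toI r))); apply: r2; rewrite ?(qK _ jN1)//;
      by move: ju uj rlt h_gt0; rewrite !qS; clear; lra.
  rewrite ltNge; apply/negP => rlt; apply: nst => u ju uj.
  apply: (le2 _ _ (x (toI (gridpt R N j)))); apply: r1; rewrite ?(qK _ jN1)//;
    by move: ju uj rlt h_gt0; rewrite !qS; clear; lra.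
have [s sP] : exists s : nat -> I01 R, forall j, (j.+1 < N)%N -> ~ steady d N e x j.+1 ->
    [/\ (j.+2 < N)%N, gridpt R N j.+1 <= val (s j.+1) < gridpt R N j.+2,
    forall u : I01 R, gridpt R N j <= val u -> val u < val (s j.+1) ->
      (d (x u) (x (toI (gridpt R N j))) <= (2 * e)%:E)%E &
    forall u : I01 R, val (s j.+1) <= val u -> val u < gridpt R N j.+3 ->
      (d (x u) (x (s j.+1)) <= e%:E)%E].
  have /choice[s sP] j : exists r : I01 R, (j.+1 < N)%N -> ~ steady d N e x j.+1 ->
      [/\ (j.+2 < N)%N, gridpt R N j.+1 <= val r < gridpt R N j.+2,
      forall u : I01 R, gridpt R N j <= val u -> val u < val r ->
        (d (x u) (x (toI (gridpt R N j))) <= (2 * e)%:E)%E &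
      forall u : I01 R, val r <= val u -> val u < gridpt R N j.+3 -> (d (x u) (x r) <= e%:E)%E].
    have [[jN nst]|nj] := pselect ((j.+1 < N)%N /\ ~ steady d N e x j.+1).
      by have [r] := brk j jN nst; exists r.
    by exists (I0 R) => jN nst; case: nj.
  by exists (fun j => s j.-1) => j; exact: sP.
exists s; split => // i j ij jN ni nj; rewrite leqNgt; apply/negP => ji.
have jiq : gridpt R N j.+1 - gridpt R N i <= delta.
  have : gridpt R N j <= gridpt R N i.+2.
    by apply: q_le; rewrite -addn2; move: ji; rewrite addn3 ltnS addn2.
  by move: hd; rewrite !qS; clear; lra.
have i0 : 0 <= gridpt R N i by rewrite -q0 q_le.
have j1 : gridpt R N j.+1 <= 1 by rewrite -qN q_le.
have ij' : gridpt R N i.+1 <= gridpt R N j by exact: q_le.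
have iN : (i <= N)%N by apply: ltnW; exact: ltn_trans jN.
move: ij'; rewrite qS => ij'.
have [||//|//|r [_ r1 r2]] :=
  @tame_break R T d x e delta (gridpt R N i) (gridpt R N j.+1) cx e_gt0 tx.
- by [].
- by rewrite qS; move: ij' h_gt0; clear; lra.
have [rj|jr] := leP r (gridpt R N j).
  have qSj := qS j; apply: nj => u ju uj.
  by apply: (le1 _ _ (x (toI r))); apply: r2;
    rewrite ?(qK _ (ltnW jN)); move: ju uj rj qSj h_gt0; clear; lra.
apply: ni => u iu; rewrite qS => ui.
by apply: (le2 _ _ (x (toI (gridpt R N i)))); apply: r1;
  rewrite ?(qK _ iN); move: iu ui ij' jr h_gt0; clear; lra.
Qed.

(** * Matching two tame paths *)

Lemma le_normB (R : realDomainType) (h a b : R) :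
  h + a <= b \/ h + b <= a -> h <= `|a - b|.
Proof.
case=> hab; last by apply: le_trans (ler_norm _); rewrite lerBrDr.
by rewrite distrC; apply: le_trans (ler_norm _); rewrite lerBrDr.
Qed.

(** The time change adds to the identity, for each break s j, a tent of height
    s' j - s j and half-width 1/N centred at s j. The tents live in disjoint windows,
    so the break of x goes exactly to that of y and the ends of the windows stay fixed;
    their slopes are at most D * N, which bounds the logarithmic norm. Outside the
    windows the time change is the identity and the cells are steady for both
    paths. *)
Lemma tame_match (R : realType) (T : pseudoMetricType R) (d : gauge T) (N : nat)
    (e : R) (x y : I01 R -> T) (s s' : nat -> I01 R) (c D : R) :
  (0 < N)%N -> 0 < e ->
  breaks d N e x s -> breaks d N e y s' ->
  (forall j, (j < N)%N -> steady d N e x j <-> steady d N e y j) ->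
  (forall j, (j < N)%N -> `|val (s' j) - val (s j)| <= D) ->
  D * N%:R ^+ 2 <= 1 - expR (- c) ->
  (forall j, (j <= N)%N -> (d (x (toI (gridpt R N j))) (y (toI (gridpt R N j))) <= e%:E)%E) ->
  (forall j, (j < N)%N -> (d (x (s j)) (y (s' j)) <= e%:E)%E) ->
  exists l, [/\ time_change l, (log_norm l <= c%:E)%E &
    forall t, (d (x t) (y (l t)) <= (9 * e)%:E)%E].
Proof.
move=> N0 e_gt0 [x0 xs xfar] [y0 ys _] xy ss Dc qxy sxy.
pose h : R := N%:R^-1.
have h_gt0 : 0 < h by rewrite invr_gt0 ltr0n.
have qS j : gridpt R N j.+1 = gridpt R N j + h := gridptS R N j.
have q_le i j : (i <= j)%N -> gridpt R N i <= gridpt R N j := @gridpt_le R N i j.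
have q0 : gridpt R N 0 = 0 := gridpt0 R N.
have qN : gridpt R N N = 1 := gridptN R N0.
have qK j : (j <= N)%N -> val (toI (gridpt R N j) : I01 R) = gridpt R N j := @gridptK R N N0 j.
have D_ge0 : 0 <= D by exact: le_trans (normr_ge0 _) (ss _ N0).
(* w j is the displacement of the break of cell j, and f the total displacement. *)
pose tent (r : R) := Num.max 0 (1 - `|r|).
pose w j := if `[< steady d N e x j >] then 0 else val (s' j) - val (s j).
pose f (r : R) := \sum_(j < N) w j * tent ((r - val (s j)) / h).
have w_le j : (j < N)%N -> `|w j| <= D.
  by move=> jN; rewrite /w; case: asboolP => _; rewrite ?normr0//; exact: ss.
have tent_lip (r r' : R) : `|tent r - tent r'| <= `|r - r'|.
  have := lerB_dist r r'; have := lerB_dist r' r; rewrite [`|r' - r|]distrC /tent.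
  have := normr_ge0 (r - r'); move: `|r - r'| `|r| `|r'|; clear => a b c.
  by case: (leP 0 (1 - b)); case: (leP 0 (1 - c)) => *; rewrite ler_norml;
    apply/andP; split; lra.
have f_lip (r r' : R) : `|f r - f r'| <= (1 - expR (- c)) * `|r - r'|.
  rewrite /f -sumrB; apply: le_trans (ler_norm_sum _ _ _) _.
  apply: (@le_trans _ _ (\sum_(j < N) (D * N%:R * `|r - r'|))).
    apply: ler_sum => j _; rewrite -mulrBr normrM -mulrA.
    apply: ler_pM => //; first exact: w_le.
    apply: le_trans (tent_lip _ _) _; rewrite -mulrBl opprB addrA subrK normrM.
    by rewrite mulrC /h invrK ger0_norm// ler0n.
  rewrite sumr_const card_ord -[X in X <= _]mulr_natr mulrAC -(mulrA D) -expr2.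
  by rewrite ler_wpM2r.
have f_eq0 (r : R) :
    (forall j, (j < N)%N -> ~ steady d N e x j -> h <= `|r - val (s j)|) -> f r = 0.
  move=> far; rewrite /f big1// => j _; rewrite /w.
  case: asboolP => [_|/(far _ (ltn_ord j)) hr]; first by rewrite mul0r.
  have hV : 0 <= h^-1 by rewrite invr_ge0 ltW.
  by rewrite /tent max_l ?mulr0// subr_le0 normrM (ger0_norm hV) ler_pdivlMr// mul1r.
have s_cell j : (j < N)%N -> ~ steady d N e x j -> exists2 k, j = k.+1 &
    (k.+2 < N)%N /\ gridpt R N k.+1 <= val (s k.+1) < gridpt R N k.+2.
  by case: j => [_ []//|k kN nst]; exists k => //; have [? ? _ _] := xs k kN nst.
have far i j : (i < j)%N -> (j < N)%N -> ~ steady d N e x i -> ~ steady d N e x j ->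
    gridpt R N i.+3 <= gridpt R N j.
  by move=> ij jN ni nj; apply: q_le; rewrite -addn3; exact: xfar.
have f_at i : (i < N)%N -> ~ steady d N e x i -> f (val (s i)) = val (s' i) - val (s i).
  move=> iN ni; rewrite /f (bigD1 (Ordinal iN))//= big1 => [|j ji].
    rewrite addr0 subrr mul0r /tent normr0 subr0 max_r ?ler01// mulr1 /w.
    by case: asboolP.
  apply/eqP; rewrite mulf_eq0; apply/orP; rewrite /w; case: asboolP => [_|nj]; [by left|right].
  have [k ik [_ /andP[i1 i2]]] := s_cell i iN ni.
  have [k' jk [_ /andP[j1 j2]]] := s_cell j (ltn_ord j) nj.
  have hV : 0 <= h^-1 by rewrite invr_ge0 ltW.
  have hs : h <= `|val (s i) - val (s j)|.
    have [ij|ij|ij] := ltngtP i j; last by case/eqP: ji; apply: val_inj.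
      apply: le_normB; left; move: (far i j ij (ltn_ord j) ni nj) i2 j1 h_gt0.
      by rewrite ik jk !qS; clear; lra.
    apply: le_normB; right; move: (far j i ij iN nj ni) i1 j2 h_gt0.
    by rewrite ik jk !qS; clear; lra.
  by rewrite /tent max_l// subr_le0 normrM (ger0_norm hV) ler_pdivlMr// mul1r.
have f0 : f 0 = 0.
  apply: f_eq0 => j jN nj; have [k -> [_ /andP[+ _]]] := s_cell j jN nj.
  rewrite qS => sk; apply: le_normB; left; move: sk (q_le _ _ (leq0n k)) h_gt0.
  by rewrite q0; clear; lra.
have f1 : f 1 = 0.
  apply: f_eq0 => j jN nj; have [k -> [kN /andP[_ sk]]] := s_cell j jN nj.
  apply: le_normB; right; move: sk (q_le _ _ kN) h_gt0.
  by rewrite qN !qS; clear; lra.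
have [|||l [tl lc lE]] := @time_changeP R (fun r => r + f r) c.
- by rewrite f0 addr0.
- by rewrite f1 addr0.
- move=> r r' _ rr' _; have := f_lip r' r; have := le_expRN1 c.
  rewrite (@ger0_norm _ (r' - r)) ?subr_ge0 ?(ltW rr')// ler_norml => ec /andP[].
  have : (1 - expR (- c)) * (r' - r) <= (expR c - 1) * (r' - r).
    by rewrite ler_wpM2r// subr_ge0 ltW.
  rewrite !mulrBl !mul1r; clear => *; apply/andP; split; lra.
exists l; split => // t.
have [t1|t1] := eqVneq (val t) 1.
  have -> : t = toI (gridpt R N N) by apply: val_inj; rewrite qK// qN.
  have -> : toI (gridpt R N N) = I1 R by apply: val_inj; rewrite qK// qN.
  rewrite time_change1//; have := qxy N (leqnn N); rewrite qN.
  have -> : toI 1 = I1 R by apply: val_inj; rewrite toIK// ler01 lexx.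
  by apply: le_gdistW; move: e_gt0; clear; lra.
have {t1} t1 : val t < 1 by rewrite lt_neqAle t1 I01_le1.
have [[k [kN nk kt tk]]|nobad] :=
    pselect (exists k, [/\ (k.+1 < N)%N, ~ steady d N e x k.+1,
      gridpt R N k <= val t & val t < gridpt R N k.+3]).
  have [k3N /andP[s1 s2] x1 x2] := xs k kN nk.
  have nyk : ~ steady d N e y k.+1 by move/(xy _ kN).2.
  have [_ /andP[s'1 s'2] y1 y2] := ys k kN nyk.
  have kN' : (k <= N)%N by rewrite ltnW// ltnW.
  have fk : f (gridpt R N k) = 0.
    apply: f_eq0 => j jN nj; have [k' jk [_ /andP[j1 j2]]] := s_cell j jN nj.
    rewrite -jk in j1 j2; have [jlt|jgt|jE] := ltngtP j k.+1.
    - apply: le_normB; right; move: (far j k.+1 jlt kN nj nk) j2 h_gt0.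
      by rewrite !qS; clear; lra.
    - apply: le_normB; left; move: (far k.+1 j jgt jN nk nj) j1 h_gt0.
      by rewrite !qS; clear; lra.
    - by apply: le_normB; left; move: j1 h_gt0; rewrite jE !qS; clear; lra.
  have fk3 : f (gridpt R N k.+3) = 0.
    apply: f_eq0 => j jN nj; have [k' jk [_ /andP[j1 j2]]] := s_cell j jN nj.
    rewrite -jk in j1 j2; have [jlt|jgt|jE] := ltngtP j k.+1.
    - apply: le_normB; right; move: (far j k.+1 jlt kN nj nk) j2 h_gt0.
      by rewrite !qS; clear; lra.
    - apply: le_normB; left; move: (far k.+1 j jgt jN nk nj) j1 h_gt0.
      by rewrite !qS; clear; lra.
    - by apply: le_normB; right; move: j2 h_gt0; rewrite jE !qS; clear; lra.
  have lsk : val (l (s k.+1)) = val (s' k.+1) by rewrite lE f_at// addrC subrK.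
  have [ts|st] := ltP (val t) (val (s k.+1)).
    have h1 := x1 t kt ts; have h2 := qxy k kN'.
    have h3 : (d (y (l t)) (y (toI (gridpt R N k))) <= (2 * e)%:E)%E.
      apply: y1; last by rewrite -lsk time_change_lt.
      have : val (l (toI (gridpt R N k))) <= val (l t) by rewrite time_change_le// qK.
      by rewrite lE qK// fk addr0.
    by apply: le_gdistW (le_gdistD (le_gdistD h1 h2) (le_gdistC h3)); move: e_gt0; clear; lra.
  have h1 := x2 t st tk; have h2 := sxy _ kN.
  have h3 : (d (y (l t)) (y (s' k.+1)) <= e%:E)%E.
    apply: y2; first by rewrite -lsk time_change_le.
    have : val (l t) < val (l (toI (gridpt R N k.+3))) by rewrite time_change_lt// qK.
    by rewrite lE [in X in _ < X](lE) qK// fk3 addr0.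
  by apply: le_gdistW (le_gdistD (le_gdistD h1 h2) (le_gdistC h3)); move: e_gt0; clear; lra.
have lt : l t = t.
  apply: val_inj; rewrite lE f_eq0 ?addr0// => j jN nj.
  have [k' jk [_ /andP[j1 j2]]] := s_cell j jN nj; rewrite jk in jN nj.
  rewrite jk; have [tk|kt] := ltP (val t) (gridpt R N k').
    by apply: le_normB; left; move: tk j1 h_gt0; rewrite !qS; clear; lra.
  have [tk|tk] := ltP (val t) (gridpt R N k'.+3); first by case: nobad; exists k'.
  by apply: le_normB; right; move: tk j2 h_gt0; rewrite !qS; clear; lra.
have [j [jN jt tj]] : exists j, [/\ (j < N)%N, gridpt R N j <= val t & val t < gridpt R N j.+1].
  have tN0 : 0 <= val t * N%:R by rewrite mulr_ge0 ?I01_ge0// ler0n.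
  have Np : 0 < N%:R :> R by rewrite ltr0n.
  have /andP[lo up] := truncn_itv tN0; exists (Num.truncn (val t * N%:R)); split.
  - by rewrite -(@ltr_nat R); apply: (le_lt_trans lo); rewrite gtr_pMl.
  - by rewrite /gridpt ler_pdivrMr.
  - by rewrite /gridpt ltr_pdivlMr.
have stj : steady d N e x j.
  apply: contrapT => nj; have [k jk _] := s_cell j jN nj; rewrite jk in jN jt tj nj.
  case: nobad; exists k; split => //; first by apply: le_trans jt; exact: q_le.
  by apply: lt_le_trans tj _; exact: q_le.
have h1 := stj t jt tj; have h2 := qxy j (ltnW jN).
have h3 := (xy j jN).1 stj t jt tj; rewrite lt.
by apply: le_gdistW (le_gdistD (le_gdistD h1 h2) (le_gdistC h3)); move: e_gt0; clear; lra.
Qed.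

(** * Ultrafilters, compactness and uniform limits of paths *)

Lemma ultra_compact_cvg (X : Type) (T : topologicalType) (F : set_system X)
    (f : X -> T) (K : set T) :
  UltraFilter F -> compact K -> F (f @^-1` K) -> exists2 p, K p & f @ F --> p.
Proof.
move=> FU cK FK; have PF := ultra_proper (UltraFilter := FU).
have [p [Kp clp]] := cK (f @ F) (fmap_proper_filter f PF) FK.
exists p => // A pA; have [//|nA] := in_ultra_setVsetC (f @^-1` A) FU.
by have [q [/= nAq Aq]] := clp (~` A) A nA pA.
Qed.

(** Only ultrafilters on A itself have to converge: a filter around the closure
    of A is replaced by the filter generated by the points of A that are close to its
    members, which clusters at the same points. *)
Lemma compact_closure_ultra (R : realType) (T : pseudoMetricType R) (A : set T) :
  (forall F : set_system T, UltraFilter F -> F A -> exists p : T, F --> p) ->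
  compact (closure A).
Proof.
move=> Acvg F PF FA.
pose G := filter_from [set Be : set T * R | F Be.1 /\ 0 < Be.2]
  (fun Be => A `&` [set x | exists2 y, Be.1 y & ball y Be.2 x]).
have PG : ProperFilter G.
  apply: filter_from_proper.
    apply: filter_from_filter; first by exists (setT, 1) => //=; split => //; exact: filterT.
    move=> [B e] [C r] /= [FB e0] [FC r0].
    exists (B `&` C, Num.min e r) => /=; first by split; [exact: filterI|rewrite lt_min e0].
    move=> x [Ax [y [By Cy] yx]]; split; split => //; exists y => //.
      by apply: le_ball yx; rewrite ge_min lexx.
    by apply: le_ball yx; rewrite ge_min lexx orbT.
  move=> [B e] /= [FB e0].
  have [y [By cly]] := filter_ex (filterI FB FA).
  by have [x [Ax yx]] := cly _ (nbhsx_ballx y e e0); exists x; split => //; exists y.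
have [U [UU GU]] := ultraFilterLemma PG.
have UA : U A.
  by apply: GU; exists (setT, 1) => /=; [split => //; exact: filterT|move=> x []].
have [p Up] := Acvg U UU UA; have PU := ultra_proper (UltraFilter := UU).
exists p; split.
  by move=> B /Up UB; have [q [? ?]] := filter_ex (filterI UA UB); exists q.
move=> B C FB /nbhs_ballP[e /= e0 eC].
have e20 : 0 < e / 2 by rewrite divr_gt0.
have UB : U (A `&` [set x | exists2 y, B y & ball y (e / 2) x]).
  by apply: GU; exists (B, e / 2).
have Ue : U (ball p (e / 2)) by apply: Up; exact: nbhsx_ballx.
have [x [[_ [y By yx]] px]] := filter_ex (filterI UB Ue).
by exists y; split => //; apply: eC; exact: ball_split px (ball_sym yx).
Qed.

Section half_powers.
Variable R : realType.

Lemma expr_half_lt (e : R) : 0 < e -> exists n, 2^-1 ^+ n < e.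
Proof.
move=> e0; exists (Num.bound e^-1); rewrite exprVn.
by rewrite invf_plt ?posrE ?exprn_gt0//; apply: upper_nthrootP.
Qed.

Lemma expr_half_gt0 n : 0 < (2^-1 : R) ^+ n.
Proof. by rewrite exprn_gt0// invr_gt0. Qed.

End half_powers.

Section cadlag_theory.
Variables (R : realType) (T : pseudoMetricType R) (d : gauge T).
Implicit Types (x y : I01 R -> T) (t u v : I01 R) (e r : R).

Lemma ultra_compact_close (X : Type) (F : set_system X) (f : X -> T) (K : set T) (r : R) :
  UltraFilter F -> compact K -> F (f @^-1` K) -> 0 < r ->
  exists2 G, F G & forall a b, G a -> G b -> (d (f a) (f b) <= r%:E)%E.
Proof.
move=> FU cK FK r0; have [p _ fp] := ultra_compact_cvg FU cK FK.
exists (f @^-1` ball p (r / 2)).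
  by apply: fp; apply: nbhsx_ballx; rewrite divr_gt0.
move=> a b; rewrite /= (ball_gdist d) /dist_ball /= => /ltW pa /ltW pb.
by rewrite (splitr r); apply: le_gdistD pb; exact: le_gdistC.
Qed.

Lemma le_gdist_lim a b e : (forall r, 0 < r -> (d a b <= (e + r)%:E)%E) -> (d a b <= e%:E)%E.
Proof. by move=> ab; apply/lee_addgt0Pr => r /ab; rewrite EFinD. Qed.

Lemma cvg_right_gdist x t p :
  (forall e, 0 < e -> exists2 r, 0 < r & forall u, val t < val u -> val u < val t + r ->
    (d p (x u) <= e%:E)%E) -> x @ at_rightI t --> p.
Proof.
move=> xp A /nbhs_ballP[e /= e0 eA]; apply/at_rightIP.
have [|r r0 tr] := xp (e / 2); first by rewrite divr_gt0.
exists r => // u tu ur; apply: eA; rewrite (ball_gdist d) /dist_ball /=.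
by apply: le_lt_trans (tr u tu ur) _; rewrite lte_fin ltr_pdivrMr// ltr_pMr// ltr1n.
Qed.

Lemma cvg_left_gdist x t p :
  (forall e, 0 < e -> exists2 r, 0 < r & forall u, val t - r < val u -> val u < val t ->
    (d p (x u) <= e%:E)%E) -> x @ at_leftI t --> p.
Proof.
move=> xp A /nbhs_ballP[e /= e0 eA]; apply/at_leftIP.
have [|r r0 tr] := xp (e / 2); first by rewrite divr_gt0.
exists r => // u tu ur; apply: eA; rewrite (ball_gdist d) /dist_ball /=.
by apply: le_lt_trans (tr u tu ur) _; rewrite lte_fin ltr_pdivrMr// ltr_pMr// ltr1n.
Qed.

Lemma at_leftI_proper t : 0 < val t -> ProperFilter (at_leftI t).
Proof.
move=> t0; apply: Build_ProperFilter_ex.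
move=> A /at_leftIP[r r0 tA]; have t1 := I01_le1 t.
(* A point of the left neighbourhood that is also nonnegative. *)
pose b := Num.max (val t / 2) (val t - r / 2).
have bt : b < val t by rewrite gt_max; apply/andP; split; lra.
have b0 : 0 <= b by rewrite le_max; apply/orP; left; rewrite divr_ge0// ltW.
have bK : val (toI b : I01 R) = b by rewrite toIK// b0 (le_trans (ltW bt)).
exists (toI b); apply: tA; rewrite bK//.
by rewrite lt_max; apply/orP; right; lra.
Qed.

(** A function whose oscillation vanishes to the left of t has a left limit
    there as soon as it has a limit along one ultrafilter finer than the left
    neighbourhoods, which compactness of K provides. *)
Lemma cadlag_compact (K : set T) x : compact K -> (forall t, K (x t)) ->
  (forall t e, val t < 1 -> 0 < e -> exists2 r, 0 < r &
    forall u, val t < val u -> val u < val t + r -> (d (x t) (x u) <= e%:E)%E) ->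
  (forall t e, 0 < val t -> 0 < e -> exists2 r, 0 < r & forall u v,
    val t - r < val u -> val u < val t -> val t - r < val v -> val v < val t ->
    (d (x u) (x v) <= e%:E)%E) -> cadlag x.
Proof.
move=> cK xK xr xl; split => t t01.
  by apply: cvg_right_gdist => e e0; exact: xr.
have PL := at_leftI_proper t01.
have [U [UU LU]] := ultraFilterLemma PL; have PU := ultra_proper (UltraFilter := UU).
have [p _ Up] : exists2 p, K p & x @ U --> p.
  by apply: ultra_compact_cvg cK _ => //; apply: filterS filterT => u _; exact: xK.
exists p; apply: cvg_left_gdist => e e0; have e20 : 0 < e / 2 by rewrite divr_gt0.
have [r r0 tr] := xl t (e / 2) t01 e20; exists r => // u ru ut.
have Ur : U [set v | val t - r < val v /\ val v < val t].
  by apply: LU; apply/at_leftIP; exists r.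
have Ue : U (x @^-1` ball p (e / 2)) by apply: Up; exact: nbhsx_ballx.
have [v [[rv vt] ]] := filter_ex (filterI Ur Ue).
rewrite /= (ball_gdist d) /dist_ball /= => /ltW pv.
by rewrite (splitr e); apply: le_gdistD pv _; exact: tr.
Qed.

Lemma cadlag_uniform_lim (K : set T) x : compact K -> (forall t, K (x t)) ->
  (forall e, 0 < e -> exists2 y, cadlag y & forall t, (d (x t) (y t) <= e%:E)%E) ->
  cadlag x.
Proof.
move=> cK xK xy; apply: (cadlag_compact cK xK) => t e t01 e0.
  have [|y cy dy] := xy (e / 3); first by rewrite divr_gt0.
  have [|r r0 tr] := @cadlag_right _ _ d y t (e / 3) cy t01; first by rewrite divr_gt0.
  exists r => // u tu ur; have h1 := dy t; have h2 := tr u (ltW tu) ur; have h3 := dy u.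
  by apply: le_gdistW (le_gdistD (le_gdistD h1 h2) (le_gdistC h3)); lra.
have [|y cy dy] := xy (e / 4); first by rewrite divr_gt0.
have [p yp] := @cadlag_left _ _ d y t cy t01.
have [|r r0 tr] := yp (e / 4); first by rewrite divr_gt0.
exists r => // u v ru ut rv vt.
have h1 := le_gdistD (dy u) (le_gdistC (tr u ru ut)).
have h2 := le_gdistD (dy v) (le_gdistC (tr v rv vt)).
by apply: le_gdistW (le_gdistD h1 (le_gdistC h2)); lra.
Qed.

Lemma cadlag_comp x (l : I01 R -> I01 R) : cadlag x -> time_change l -> cadlag (x \o l).
Proof.
move=> cx tl; have [_ lc _] := tl; split => t t01.
  apply: cvg_right_gdist => e e0.
  have lt1 : val (l t) < 1.
    by have := time_change_lt t (I1 R) tl; rewrite time_change1// val_I1 => ->.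
  have [r r0 tr] := @cadlag_right _ _ d x (l t) e cx lt1 e0.
  have /lc/nbhs_I01P[q q0 tq] : nbhs (l t) [set u | val u < val (l t) + r].
    by apply/nbhs_I01P; exists r => // u; rewrite ltr_distl => /andP[].
  exists q => // u tu uq; apply: tr; first by rewrite time_change_le// ltW.
  by apply: tq; rewrite ger0_norm ?subr_ge0 ?(ltW tu)// ltrBlDl.
have lt0 : 0 < val (l t).
  by have := time_change_lt (I0 R) t tl; rewrite time_change0// val_I0 => ->.
have [p xp] := @cadlag_left _ _ d x (l t) cx lt0; exists p.
apply: cvg_left_gdist => e e0; have [r r0 tr] := xp e e0.
have /lc/nbhs_I01P[q q0 tq] : nbhs (l t) [set u | val (l t) - r < val u].
  by apply/nbhs_I01P; exists r => // u; rewrite ltr_distl => /andP[].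
exists q => // u qu ut; apply: tr; last by rewrite time_change_lt.
by apply: tq; rewrite distrC ger0_norm ?subr_ge0 ?(ltW ut)// ltrBlDr -ltrBlDl.
Qed.

End cadlag_theory.

(** * Completeness for the logarithmic cost *)

Section infinite_composition.
Variables (R : realType) (l : nat -> I01 R -> I01 R).
Hypothesis l_tc : forall n, time_change (l n).
Hypothesis l_log : forall n, (log_norm (l n) <= (2^-1 ^+ n)%:E)%E.

Let kap := fix kap (j n : nat) : I01 R -> I01 R :=
  if j is j'.+1 then kap j' n.+1 \o l n else id.

Let kapP j n : time_change (kap j n) /\ (log_norm (kap j n) <= (2 * 2^-1 ^+ n)%:E)%E.
Proof.
elim: j n => [|j IH] n /=.
  split; first exact: time_change_id.
  by rewrite log_norm_id lee_fin mulr_ge0// ltW// expr_half_gt0.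
have [tk lk] := IH n.+1; split; first exact: time_change_comp.
apply: le_trans (log_norm_comp (l_tc n) tk) _; apply: le_trans (leeD (l_log n) lk) _.
by rewrite -EFinD lee_fin exprS; lra.
Qed.

(** mu n stands for the infinite composition of l n, l (n+1), l (n+2) and so on.
    Finite compositions have logarithmic norm at most 2 / 2^n; their limits are taken
    pointwise along an ultrafilter on nat, which exist by compactness of the unit
    interval, and the bounds on increments make the limit a time change. Taking the
    same ultrafilter for all n gives the functional equation. *)
Lemma infinite_composition : exists mu : nat -> I01 R -> I01 R, forall n,
  [/\ time_change (mu n), (log_norm (mu n) <= (2 * 2^-1 ^+ n)%:E)%E &
      mu n = mu n.+1 \o l n].
Proof.
have [U [UU ooU]] := ultraFilterLemma (eventually_filter).
have PU := ultra_proper (UltraFilter := UU).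
pose M N n := kap (N - n) n.
have /choice[mu muP] n : exists m : I01 R -> I01 R, forall t, M N n t @[N --> U] --> m t.
  have /choice[m mP] t : exists p : I01 R, M N n t @[N --> U] --> p.
    have UT : U [set N | [set: I01 R] (M N n t)] by apply: filterS filterT.
    by have [p] := @ultra_compact_cvg _ _ U (fun N => M N n t) _ UU (@compact_I01 R) UT; exists p.
  by exists m.
have vmu n t : val (M N n t) @[N --> U] --> (val (mu n t) : R).
  apply: (@cvg_comp _ _ _ (fun N => M N n t) (val : I01 R -> R)); first exact: muP.
  exact: (@initial_continuous (I01 R) R val).
have bnd n s t : val s < val t ->
    expR (- (2 * 2^-1 ^+ n)) * (val t - val s) <= val (mu n t) - val (mu n s)
      <= expR (2 * 2^-1 ^+ n) * (val t - val s).
  move=> st.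
  have cvB : val (M N n t) - val (M N n s) @[N --> U] --> (val (mu n t) - val (mu n s) : R).
    exact: cvgB.
  have MP N : expR (- (2 * 2^-1 ^+ n)) * (val t - val s) <= val (M N n t) - val (M N n s)
      <= expR (2 * 2^-1 ^+ n) * (val t - val s).
    by have [[li _ _] /(log_norm_leP _ li)] := kapP (N - n) n; apply.
  apply/andP; split.
    by apply: (cvgr_to_ge cvB); apply: nearW => N; case/andP: (MP N).
  by apply: (cvgr_to_le cvB); apply: nearW => N; case/andP: (MP N).
have fixed n t : (forall N, M N n t = t) -> mu n t = t.
  move=> Mt; apply: val_inj; apply: (cvg_unique (@Rhausdorff R) (vmu n t)).
  have -> : (fun N => val (M N n t) : R) = cst (val t) by apply/funext => N; rewrite Mt.
  exact: cvg_cst.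
have mu0 n : mu n (I0 R) = I0 R.
  by apply: fixed => N; apply: time_change0; have [] := kapP (N - n) n.
have mu1 n : mu n (I1 R) = I1 R.
  by apply: fixed => N; apply: time_change1; have [] := kapP (N - n) n.
exists mu => n.
have toI0 : toI 0 = I0 R by apply: val_inj; rewrite toIK// lexx ler01.
have toI1 : toI 1 = I1 R by apply: val_inj; rewrite toIK// ler01 lexx.
have [|||m [tm lm mE]] := @time_changeP R (fun r => val (mu n (toI r))) (2 * 2^-1 ^+ n).
- by rewrite toI0 mu0.
- by rewrite toI1 mu1.
- move=> r s r0 rs s1; have sK : val (toI s : I01 R) = s by rewrite toIK; lra.
  have rK : val (toI r : I01 R) = r by rewrite toIK; lra.
  by have := bnd n (toI r) (toI s); rewrite rK sK; exact.
have muE : mu n = m by apply/funext => t; apply: val_inj; rewrite mE toI_val.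
rewrite muE; split => //; rewrite -muE; apply/funext => t; apply: val_inj.
apply: (cvg_unique (@Rhausdorff R) (vmu n t)).
apply: cvg_trans (vmu n.+1 (l n t)); apply: near_eq_cvg.
have : U [set N | (n < N)%N] by apply: ooU; exact: nbhs_infty_ge.
apply: filterS => N /= nN; by rewrite /M -(subnSK nN).
Qed.

End infinite_composition.

Section completeness.
Variables (R : realType) (T : pseudoMetricType R) (d : gauge T).

(** Read with the clock mu n, consecutive paths are uniformly close at equal
    times, because mu n = mu n.+1 o l n. They thus converge uniformly, again along an
    ultrafilter. *)
Lemma skorohod_complete (K : set T) (x : nat -> I01 R -> T) : compact K ->
  (forall n, cadlag (x n)) -> (forall n t, K (x n t)) ->
  (forall n, exists l, [/\ time_change l, (log_norm l <= (2^-1 ^+ n)%:E)%E &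
    forall t, (d (x n t) (x n.+1 (l t)) <= (2^-1 ^+ n)%:E)%E]) ->
  exists2 x0, cadlag x0 & forall n, exists l,
    [/\ time_change l, (log_norm l <= (2 * 2^-1 ^+ n)%:E)%E &
    forall t, (d (x n t) (x0 (l t)) <= (2 * 2^-1 ^+ n)%:E)%E].
Proof.
move=> cK cx xK /choice[l lP].
have [|n|mu muP] := @infinite_composition R l; [by move=> n; case: (lP n)|by case: (lP n)|].
have /choice[nu nuP] n : exists m, time_change m /\ cancel (mu n) m /\ cancel m (mu n).
  by have [tm _ _] := muP n; have [m ? ?] := time_change_inv tm; exists m.
pose g n t := x n (nu n t).
have gS n t : (d (g n t) (g n.+1 t) <= (2^-1 ^+ n)%:E)%E.
  have [_ [_ nuK]] := nuP n; have [_ [muK _]] := nuP n.+1.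
  have [_ _ muE] := muP n; have [_ _ dl] := lP n.
  rewrite /g -{2}(nuK t) muE /= muK; exact: dl.
have gD k n t : (d (g n t) (g (n + k)%N t) <= (2 * 2^-1 ^+ n)%:E)%E.
  elim: k n => [|k IH] n.
    by rewrite addn0 gdistxx lee_fin mulr_ge0// ltW// expr_half_gt0.
  rewrite addnS -addSn; apply: le_gdistW (le_gdistD (gS n t) (IH n.+1)).
  by rewrite exprS; lra.
have [U [UU ooU]] := ultraFilterLemma (eventually_filter).
have PU := ultra_proper (UltraFilter := UU).
have /choice[x0 x0P] t : exists p, K p /\ g N t @[N --> U] --> p.
  have UT : U [set N | K (g N t)] by apply: filterS filterT => N _; exact: xK.
  by have [p] := @ultra_compact_cvg _ _ U (fun N => g N t) _ UU cK UT; exists p.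
have gx0 n t : (d (g n t) (x0 t) <= (2 * 2^-1 ^+ n)%:E)%E.
  apply: le_gdist_lim => r r0; have [_ gU] := x0P t.
  have Ub : U [set N | ball (x0 t) r (g N t)] by apply: gU; exact: nbhsx_ballx.
  have Un : U [set N | (n <= N)%N] by apply: ooU; exact: nbhs_infty_ge.
  have [N [/= nN]] := filter_ex (filterI Un Ub).
  rewrite (ball_gdist d) /dist_ball /= => /ltW Nb.
  by apply: le_gdistD (le_gdistC Nb); rewrite -(subnKC nN); exact: gD.
exists x0; last first.
  move=> n; have [tm lm _] := muP n; have [_ [muK _]] := nuP n.
  by exists (mu n); split => // t; have := gx0 n (mu n t); rewrite /g muK.
apply: (cadlag_uniform_lim (d := d) cK) => [t|e e0]; first by case: (x0P t).
have [|n ne] := @expr_half_lt R (e / 2); first by rewrite divr_gt0.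
exists (g n) => [|t]; first by apply: (cadlag_comp d); [exact: cx|case: (nuP n)].
by apply: le_gdistC; apply: le_gdistW (gx0 n t); move: ne; clear; lra.
Qed.

End completeness.

(** * Tame ultrafilters converge *)

Lemma filter_pairwise_below (X : Type) (F : set_system X) (N : nat)
    (Q : nat -> X -> X -> Prop) : Filter F ->
  (forall j, (j < N)%N -> exists2 G, F G & forall x y, G x -> G y -> Q j x y) ->
  exists2 G, F G & forall x y, G x -> G y -> forall j, (j < N)%N -> Q j x y.
Proof.
move=> FF; elim: N => [|N IH] FQ; first by exists setT => //; exact: filterT.
have [j jN|G FG GQ] := IH; first by apply: FQ; exact: ltnW.
have [H FH HQ] := FQ N (ltnSn N); exists (G `&` H); first exact: filterI.
move=> x y [Gx Hx] [Gy Hy] j; rewrite ltnS leq_eqVlt => /orP[/eqP ->|jN].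
  exact: HQ.
exact: GQ.
Qed.

Lemma ball_abs_dist (R : realType) (a e : R) : ball a e = dist_ball (@abs_dist R) a e.
Proof. by apply/seteqP; split => b; rewrite /dist_ball /= /abs_dist lte_fin. Qed.

Definition abs_gauge (R : realType) : gauge R :=
  Gauge (@abs_distxx R) (@abs_distC R) (@abs_dist_triangle R) (@ball_abs_dist R).

Definition J1_gauge (R : realType) : gauge (skoD R) :=
  @Gauge R (skoD R) (@dJ1 R) (@dJ1xx R) (@dJ1C R) (@dJ1_triangle R) (fun _ _ => erefl).

Definition DD_gauge (R : realType) : gauge (skoDD R) :=
  @Gauge R (skoDD R) (@dDD R) (@dDDxx R) (@dDDC R) (@dDD_triangle R) (fun _ _ => erefl).

Section relative_compactness.
Variables (R : realType) (T : pseudoMetricType R) (d : gauge T).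
Implicit Types (x y : I01 R -> T) (K : set T) (F : set_system (I01 R -> T)).

(** All data of a path that enter tame_match range over compact or finite
    sets, so along an ultrafilter they are eventually as close to each other as
    desired. *)
Lemma tame_ultra_close K F (e delta c : R) :
  UltraFilter F -> compact K -> 0 < e -> 0 < delta -> 0 < c ->
  F [set x | [/\ cadlag x, forall t, K (x t) & tame d e delta x]] ->
  exists2 G, F G & forall x y, G x -> G y -> exists l,
    [/\ time_change l, (log_norm l <= c%:E)%E & forall t, (d (x t) (y (l t)) <= (9 * e)%:E)%E].
Proof.
move=> FU cK e0 delta0 c0 FA; have PF := ultra_proper (UltraFilter := FU).
have delta3 : 0 <= 3 / delta by rewrite divr_ge0// ltW.
pose N := Num.bound (3 / delta).
have Nb : 3 / delta < N%:R by exact: archi_boundP.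
have N0 : (0 < N)%N by rewrite -(@ltr_nat R); apply: le_lt_trans Nb.
have NR : 0 < N%:R :> R by rewrite ltr0n.
have N3 : 3 / N%:R <= delta.
  by rewrite ler_pdivrMr// mulrC -ler_pdivrMr// ltW.
set A := [set x | _] in FA.
have /choice[S SP] x : exists s, A x -> breaks d N e x s.
  have [Ax|nAx] := pselect (A x); last by exists (fun=> I0 R).
  have [cx _ tx] := Ax.
  by have [s sP] := tame_breaks N0 e0 cx tx N3; exists s.
(* Displacements of breaks up to D keep the logarithmic norm of tame_match below c. *)
pose D : R := (1 - expR (- c)) / N%:R ^+ 2.
have D0 : 0 < D.
  by rewrite divr_gt0 ?exprn_gt0// subr_gt0 -expR0 ltr_expR oppr_lt0.
have FK (f : (I01 R -> T) -> I01 R) : F ((fun x => x (f x)) @^-1` K).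
  by apply: filterS FA => x [_ xK _]; exact: xK.
have [j _|G1 FG1 G1P] := @filter_pairwise_below _ F N
    (fun j x y => steady d N e x j <-> steady d N e y j) _.
  have [Fs|Fs] := in_ultra_setVsetC [set x | steady d N e x j] FU.
    by exists [set x | steady d N e x j].
  by exists (~` [set x | steady d N e x j]).
have [j _|G2 FG2 G2P] := @filter_pairwise_below _ F N
    (fun j x y => `|val (S y j) - val (S x j)| <= D) _.
  have [|||G FG GP] := @ultra_compact_close R R (abs_gauge R) _ F
      (fun x => val (S x j)) `[0, 1]%classic D FU.
  - exact: segment_compact.
  - by apply: filterS filterT => x _; rewrite /= in_itv /= I01_itv.
  - exact: D0.
  exists G => // x y Gx Gy; have := GP y x Gy Gx.
  by rewrite /= /abs_dist lee_fin.
have [j _|G3 FG3 G3P] := @filter_pairwise_below _ F N.+1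
    (fun j x y => (d (x (toI (gridpt R N j))) (y (toI (gridpt R N j))) <= e%:E)%E) _.
  exact: (@ultra_compact_close R T d _ F (fun x => x (toI (gridpt R N j))) K e FU cK
    (FK (fun=> _)) e0).
have [j _|G4 FG4 G4P] := @filter_pairwise_below _ F N
    (fun j x y => (d (x (S x j)) (y (S y j)) <= e%:E)%E) _.
  exact: (@ultra_compact_close R T d _ F (fun x => x (S x j)) K e FU cK (FK (S ^~ j)) e0).
exists (A `&` (G1 `&` G2) `&` (G3 `&` G4)); first by do ![apply: filterI => //].
move=> x y [[Ax [x1 x2]] [x3 x4]] [[Ay [y1 y2]] [y3 y4]].
apply: (@tame_match _ _ _ _ _ _ _ _ _ _ D N0 e0 (SP x Ax) (SP y Ay)).
- exact: G1P.
- exact: G2P.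
- by rewrite divfK// expf_neq0// gt_eqF.
- exact: G3P.
- exact: G4P.
Qed.

(** The ultrafilter is Cauchy by tame_ultra_close, hence there is a sequence
    of paths, taken from decreasing members of the ultrafilter, to which
    skorohod_complete applies. *)
Lemma tame_ultra_cvg K F : UltraFilter F -> compact K ->
  F [set x | cadlag x /\ forall t, K (x t)] ->
  (forall e : R, 0 < e -> exists2 delta, 0 < delta & F [set x | tame d e delta x]) ->
  exists2 x0, cadlag x0 & forall c, 0 < c -> F [set x | exists l,
    [/\ time_change l, (log_norm l <= c%:E)%E & forall t, (d (x t) (x0 (l t)) <= c%:E)%E]].
Proof.
move=> FU cK FA Ftame; have PF := ultra_proper (UltraFilter := FU).
pose p n : R := 2^-1 ^+ n; have p0 n : 0 < p n := expr_half_gt0 R n.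
have /choice[G GP] n : exists G : set (I01 R -> T), F G /\ forall x y, G x -> G y ->
    exists l, [/\ time_change l, (log_norm l <= (p n)%:E)%E &
      forall t, (d (x t) (y (l t)) <= (p n)%:E)%E].
  have p9 : 0 < p n / 9 by rewrite divr_gt0.
  have [delta delta0 Fd] := Ftame _ p9.
  have [|G FG GP] := @tame_ultra_close K F (p n / 9) delta (p n) FU cK p9 delta0 (p0 n).
    by apply: filterS (filterI FA Fd) => x [[? ?] ?].
  by exists G; split => // x y Gx Gy; have := GP x y Gx Gy; rewrite mulrC divfK.
pose A : set (I01 R -> T) := [set x | cadlag x /\ forall t, K (x t)].
pose H n : set (I01 R -> T) := fun x => A x /\ forall k, (k < n.+1)%N -> G k x.
have FG n : F [set x | forall k, (k < n)%N -> G k x].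
  elim: n => [|n IH].
    by apply: (@filterS _ F _ setT) => [x _ k|]; [rewrite ltn0|exact: filterT].
  apply: filterS (filterI IH (GP n).1) => x [xk xn] k.
  by rewrite ltnS leq_eqVlt => /orP[/eqP ->|/xk].
have FH n : F (H n) by exact: filterI FA (FG n.+1).
have /choice[x xH] n : exists x, H n x by exact: filter_ex (FH n).
have [||n|x0 cx0 x0P] := @skorohod_complete R T d K x cK.
- by move=> n; have [[]] := xH n.
- by move=> n t; have [[_ xnK] _] := xH n; exact: xnK.
- by apply: (GP n).2; [have [_ xk] := xH n|have [_ xk] := xH n.+1]; apply: xk.
exists x0 => // c c0.
have [|n nc] := @expr_half_lt R (c / 3); first by rewrite divr_gt0.
apply: filterS (GP n).1 => y Gy.
have [_ /(_ n (ltnSn n)) Gx] := xH n.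
have [l [tl ll dl]] := (GP n).2 y (x n) Gy Gx.
have [m [tm lm dm]] := x0P n.
have pc : p n + 2 * p n <= c by move: nc; rewrite -/(p n); clear; lra.
exists (m \o l); split; first exact: time_change_comp.
  apply: le_trans (log_norm_comp tl tm) _; apply: le_trans (leeD ll lm) _.
  by rewrite -EFinD lee_fin.
by move=> t; apply: le_gdistW pc (le_gdistD (dl t) (dm (l t))).
Qed.

End relative_compactness.

(** * Local properties of paths and the compactness criterion *)

Lemma ultra_fmap (X Y : Type) (f : X -> Y) (F : set_system X) :
  UltraFilter F -> UltraFilter (f @ F).
Proof.
move=> FU; have PF := ultra_proper (UltraFilter := FU).
split; first exact: fmap_proper_filter.
move=> G PG FG; apply/seteqP; split => // A GA.
have [//|nA] := in_ultra_setVsetC (f @^-1` A) FU.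
have GnA : G (~` A) by apply: FG.
by have [y []] := filter_ex (filterI GA GnA).
Qed.

(** Near each point, Q k holds for all large k. This is the form in which a
    property depending on a small parameter passes to compact sets, to the values of
    paths, and to probability measures. *)
Definition locally_eventually (X : topologicalType) (Q : nat -> set X) :=
  forall a : X, exists k0, nbhs a [set b | forall k, (k0 <= k)%N -> Q k b].

Lemma nbhs_gauge (R : realType) (X : pseudoMetricType R) (d : gauge X) (a : X) (A : set X) :
  nbhs a A <-> exists2 r : R, 0 < r & forall b, (d a b <= r%:E)%E -> A b.
Proof.
split=> [/nbhs_ballP[e /= e0 eA]|[r r0 rA]].
  exists (e / 2) => [|b ab]; first by rewrite divr_gt0.
  apply: eA; rewrite (ball_gdist d) /dist_ball /=.
  by apply: le_lt_trans ab _; rewrite lte_fin ltr_pdivrMr// ltr_pMr// ltr1n.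
apply/nbhs_ballP; exists r => // b; rewrite (ball_gdist d) /dist_ball /= => /ltW.
exact: rA.
Qed.

(** A Lebesgue number argument on the unit interval. *)
Lemma uniform_I01 (R : realType) (P : nat -> I01 R -> Prop) :
  (forall t : I01 R, exists2 r : R, 0 < r & exists n, forall m (u : I01 R),
    `|val u - val t| < r -> (n <= m)%N -> P m u) ->
  exists n, forall u, P n u.
Proof.
move=> locP; have /compact_near_coveringP cov := @compact_I01 R.
have : \forall n \near \oo, [set: I01 R] `<=` P n.
  apply: cov => t _; have [r r0 [n nP]] := locP t.
  exists ([set u | `|val u - val t| < r], [set m | (n <= m)%N]) => /=.
    by split; [apply/nbhs_I01P; exists r|exact: nbhs_infty_ge].
  by move=> [u m] /= [ut nm]; exact: nP.
by move=> /filter_ex[n nP]; exists n => u; exact: nP.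
Qed.

Section cadlag_local.
Variables (R : realType) (T : pseudoMetricType R) (d : gauge T).
Implicit Types (x y : I01 R -> T) (s t u v : I01 R) (e r : R).

(** At the end points of the interval one of the two sides is empty, so no
    case distinction on t is left to the applications. *)
Lemma cadlag_sides y t : cadlag y -> exists p, forall e, 0 < e -> exists2 r, 0 < r &
  (forall u, val t <= val u -> val u < val t + r -> (d (y t) (y u) <= e%:E)%E) /\
  (forall u, val t - r < val u -> val u < val t -> (d p (y u) <= e%:E)%E).
Proof.
move=> cy.
have right e : 0 < e -> exists2 r, 0 < r & forall u, val t <= val u -> val u < val t + r ->
    (d (y t) (y u) <= e%:E)%E.
  move=> e0; have [t1|t1] := ltP (val t) 1; first exact: cadlag_right.
  exists 1 => // u tu _; have -> : u = t.
    by apply: val_inj; apply/le_anti; rewrite tu (le_trans (I01_le1 u)).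
  by rewrite gdistxx lee_fin ltW.
have [t0|t0] := ltP 0 (val t); last first.
  exists (y t) => e /right[r r0 rP]; exists r => //; split => // u _ ut.
  by have := lt_le_trans ut t0; rewrite ltNge I01_ge0.
have [p yp] := cadlag_left d cy t0; exists p => e e0.
have [r1 r10 r1P] := right e e0; have [r2 r20 r2P] := yp e e0.
exists (Num.min r1 r2); first by rewrite lt_min r10.
split=> u tu ut.
  by apply: r1P => //; apply: lt_le_trans ut _; rewrite lerD2l ge_min lexx.
by apply: r2P => //; apply: le_lt_trans tu; rewrite lerB// ge_min lexx orbT.
Qed.

Lemma invS_lt (r : R) : 0 < r -> exists n, forall m, (n <= m)%N -> (m.+1%:R^-1 : R) < r.
Proof.
move=> r0; exists (Num.bound r^-1) => m nm; rewrite invf_plt ?posrE ?ltr0n//.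
apply: lt_le_trans (archi_boundP _) _; first by rewrite invr_ge0 ltW.
by rewrite ler_nat ltnW.
Qed.

(** Around each time c the path oscillates little on either side of c. By
    compactness a short triple s1 <= s <= s2 lies in such a neighbourhood of some c,
    and then s is on the same side of c as s1 or as s2. *)
Lemma cadlag_tame y e : cadlag y -> 0 < e -> exists2 delta, 0 < delta & tame d e delta y.
Proof.
move=> cy e0; have e20 : 0 < e / 2 by rewrite divr_gt0.
have dd a b p : (d p a <= (e / 2)%:E)%E -> (d p b <= (e / 2)%:E)%E -> (d a b <= e%:E)%E.
  by move=> pa pb; rewrite (splitr e); exact: le_gdistD (le_gdistC pa) pb.
have [n nP] : exists n, forall u, exists c : I01 R, forall s s',
    `|val s - val u| < n.+1%:R^-1 -> `|val s' - val u| < n.+1%:R^-1 ->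
    (val s < val c) = (val s' < val c) -> (d (y s) (y s') <= e%:E)%E.
  apply: uniform_I01 => t.
  have [p /(_ _ e20)[r r0 [rP lP]]] := cadlag_sides t cy.
  have r20 : 0 < r / 2 by rewrite divr_gt0.
  have [n nr] := invS_lt r20; exists (r / 2) => //; exists n.
  move=> m u ut nm; exists t => s s' su s'u; have nmr := nr m nm.
  have st : `|val s - val t| < r.
    rewrite (splitr r); apply: le_lt_trans (ler_distD (val u) _ _) _.
    by rewrite ltrD// (lt_trans su).
  have s't : `|val s' - val t| < r.
    rewrite (splitr r); apply: le_lt_trans (ler_distD (val u) _ _) _.
    by rewrite ltrD// (lt_trans s'u).
  move: st s't; rewrite !ltr_distl => /andP[s1 s2] /andP[s'1 s'2].
  have [sc s'c|cs cs'] := ltP (val s) (val t).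
    by apply: (dd _ _ p); apply: lP; rewrite -?s'c.
  by apply: (dd _ _ (y t)); apply: rP => //; rewrite leNgt -cs'.
pose q : R := n.+1%:R^-1; have q0 : 0 < q by rewrite invr_gt0 ltr0n.
have [_ /(_ _ e0)[r1 r10 [r1P _]]] := cadlag_sides (I0 R) cy.
have [p /(_ _ e20)[r2 r20 [_ r2P]]] := cadlag_sides (I1 R) cy.
pose delta := Num.min (q / 2) (Num.min (r1 / 2) (r2 / 2)).
have dq : delta <= q / 2 by rewrite ge_min lexx.
have d1 : delta <= r1 / 2 by rewrite !ge_min lexx orbT.
have d2 : delta <= r2 / 2 by rewrite !ge_min lexx !orbT.
exists delta; first by rewrite !lt_min !divr_gt0.
split.
- move=> s1 s s2 s1s ss2 s21; have [c cP] := nP s1.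
  have close (u : I01 R) : val s1 <= val u -> val u <= val s2 -> `|val u - val s1| < q.
    move=> s1u us2; rewrite ger0_norm ?subr_ge0//.
    by move: us2 s21 dq q0; clear; lra.
  have h1 := close s1 (lexx _) (le_trans s1s ss2); have h2 := close s s1s ss2.
  have h3 := close s2 (le_trans s1s ss2) (lexx _).
  have [sc|cs] := ltP (val s) (val c).
    by left; apply: cP => //; rewrite sc (le_lt_trans s1s).
  right; apply: cP => //.
  by rewrite !ltNge cs (le_trans cs).
- move=> s sd; apply: le_gdistC; apply: r1P; first by rewrite val_I0 I01_ge0.
  by rewrite val_I0; move: sd d1 r10; clear; lra.
- move=> s s' ds s1 ds' s'1; apply: (dd _ _ p); apply: r2P => //; rewrite val_I1.
    by move: ds d2 r20; clear; lra.
  by move: ds' d2 r20; clear; lra.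
Qed.

Lemma tame_perturb x y (l : I01 R -> I01 R) e (delta : R) :
  tame d e delta y -> time_change l -> (dev_norm l <= (delta / 4)%:E)%E ->
  (forall t, (d (x t) (y (l t)) <= e%:E)%E) -> tame d (3 * e) (delta / 2) x.
Proof.
move=> [y1 y2 y3] tl /dev_norm_leP ldev xy.
have lo t : val t - delta / 4 <= val (l t).
  by have := ldev t; rewrite ler_norml => /andP[+ _]; clear; lra.
have up t : val (l t) <= val t + delta / 4.
  by have := ldev t; rewrite ler_norml => /andP[_ +]; clear; lra.
have tr a b : (d (y (l a)) (y (l b)) <= e%:E)%E -> (d (x a) (x b) <= (3 * e)%:E)%E.
  move=> ab; have := le_gdistD (le_gdistD (xy a) ab) (le_gdistC (xy b)).
  by apply: le_gdistW; lra.
have l0 := time_change0 tl; have l1 := time_change1 tl.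
split.
- move=> s1 s s2 s1s ss2 s21.
  have [||||] := y1 (l s1) (l s) (l s2); rewrite ?time_change_le//.
  + by move: (lo s1) (up s2) s21; clear; lra.
  + by left; exact: tr.
  + by right; exact: tr.
- move=> s sd; apply: tr; rewrite l0; apply: y2.
  by have := up (I0 R); have := ldev (I0 R); rewrite l0 subrr normr0; move: (up s) sd; clear; lra.
- have lt1 s : val s < 1 -> val (l s) < 1.
    by have := time_change_lt s (I1 R) tl; rewrite l1 val_I1 => ->.
  have d0 : 0 <= delta / 4 by apply: le_trans (ldev (I0 R)).
  move=> s s' ds s1 ds' s'1; apply: tr; apply: y3; rewrite ?lt1//.
    by move: (lo s) ds d0; clear; lra.
  by move: (lo s') ds' d0; clear; lra.
Qed.

Lemma tame_le x e e' (delta delta' : R) : e <= e' -> delta' <= delta ->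
  tame d e delta x -> tame d e' delta' x.
Proof.
move=> ee' dd' [x1 x2 x3]; split.
- move=> s1 s s2 s1s ss2 s21.
  by have [||| /(le_gdistW ee')|/(le_gdistW ee')] := x1 s1 s s2; rewrite ?(le_trans s21)//; tauto.
- by move=> s sd; apply: le_gdistW ee' _; apply: x2; exact: le_trans dd'.
- have dd : 1 - delta <= 1 - delta' by rewrite lerB.
  by move=> s s' ds s1 ds' s'1; apply: le_gdistW ee' _; apply: x3; rewrite // (le_trans dd).
Qed.

End cadlag_local.

(** The two path spaces of the theorem have this form: skoD over the real
    line with the logarithmic cost, skoDD over skoD with the uniform cost. The last two
    fields are all that is needed of the cost: small logarithmic norm makes it small,
    and when it is small the time change is uniformly close to the identity. *)
Record skorohod_space (R : realType) (T : pseudoMetricType R) (d : gauge T)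
    (X : pseudoMetricType R) (dX : gauge X) := SkorohodSpace {
  path_of : X -> I01 R -> T;
  path_cadlag : forall a, cadlag (path_of a);
  path_surj : forall x, cadlag x -> exists a, path_of a = x;
  path_inj : injective path_of;
  clock_cost : (I01 R -> I01 R) -> \bar R;
  gdist_pathE : forall a b, dX a b = skorohod_dist clock_cost d (path_of a) (path_of b);
  cost_le_log : forall e, 0 < e -> exists2 c, 0 < c &
    forall l, time_change l -> (log_norm l <= c%:E)%E -> (clock_cost l <= e%:E)%E;
  dev_le_cost : forall e, 0 < e -> exists2 c, 0 < c &
    forall l, time_change l -> (clock_cost l <= c%:E)%E -> (dev_norm l <= e%:E)%E }.

Section skorohod_space_theory.
Variables (R : realType) (T : pseudoMetricType R) (d : gauge T).
Variables (X : pseudoMetricType R) (dX : gauge X) (S : skorohod_space d dX).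
Implicit Types (e r : R).

(** The ultrafilter converges for the logarithmic cost, which dominates the
    cost of the space. *)
Lemma compact_closure_tame (K : set T) (A : set X) : compact K ->
  (forall a t, A a -> K (path_of S a t)) ->
  (forall e, 0 < e -> exists2 delta, 0 < delta & forall a, A a -> tame d e delta (path_of S a)) ->
  compact (closure A).
Proof.
move=> cK AK At; apply: compact_closure_ultra => F FU FA.
have PF := ultra_proper (UltraFilter := FU).
have [||x0 cx0 Fx0] := @tame_ultra_cvg R T d K (path_of S @ F) (ultra_fmap _ FU) cK.
- apply: (filterS (F := F) _ FA) => a Aa; split => [|t]; [exact: path_cadlag|exact: AK].
- move=> e e0; have [delta delta0 tA] := At e e0; exists delta => //.
  by apply: (filterS (F := F) _ FA) => a /tA.
have [p pE] := path_surj S cx0; exists p => B /(nbhs_gauge dX)[r r0 rB].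
have [c c0 cP] := cost_le_log S r0.
have cr0 : 0 < Num.min c r by rewrite lt_min c0.
apply: (filterS (F := F) _ (Fx0 _ cr0)) => a [l [tl ll dl]]; apply: rB; apply: le_gdistC.
rewrite (gdist_pathE S) pE; apply: (skorohod_dist_le tl).
  by apply: cP => //; apply: le_trans ll _; rewrite lee_fin ge_min lexx.
by move=> t; apply: le_gdistW (dl t); rewrite ge_min lexx orbT.
Qed.

Lemma locally_tame e : 0 < e ->
  locally_eventually (fun k a => tame d e (k.+1%:R^-1) (path_of S a)).
Proof.
move=> e0 a; have e30 : 0 < e / 3 by rewrite divr_gt0.
have [delta delta0 ta] := cadlag_tame d (path_cadlag S a) e30.
have delta40 : 0 < delta / 4 by rewrite divr_gt0.
have delta20 : 0 < delta / 2 by rewrite divr_gt0.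
have [c c0 cP] := dev_le_cost S delta40; have [n nd] := invS_lt delta20.
have r0 : 0 < Num.min c (e / 3) by rewrite lt_min c0.
exists n; apply/nbhs_ballP; exists (Num.min c (e / 3)) => // b /ball_sym.
rewrite (ball_gdist dX) /dist_ball /= (gdist_pathE S) => ba k nk.
have [l [tl cl dl]] := skorohod_dist_ltP ba.
have := @tame_perturb _ _ d (path_of S b) (path_of S a) l (e / 3) delta ta tl.
move=> /(_ _ _)/wrap[||t3].
- by apply: cP => //; apply: le_trans cl _; rewrite lee_fin ge_min lexx.
- by move=> t; apply: le_gdistW (dl t); rewrite ge_min lexx orbT.
by apply: tame_le t3; [rewrite mulrC divfK|exact/ltW/nd].
Qed.

(** Near each time t the values of the path are near x(t) or near the left
    limit of x at t, and the values of a neighbouring path are near values of x; by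
    compactness of the unit interval finitely many such points suffice. *)
Lemma locally_path (Q : nat -> set T) : locally_eventually Q ->
  locally_eventually (fun k a => forall t, Q k (path_of S a t)).
Proof.
move=> locQ a; pose y := path_of S a; have cy : cadlag y := path_cadlag S a.
pose P n u := forall k z, (n <= k)%N -> (d (y u) z <= (n.+1%:R^-1)%:E)%E -> Q k z.
have [n nP] : exists n, forall u, P n u.
  apply: uniform_I01 => t; have [p sides] := cadlag_sides d t cy.
  have [k1 /(nbhs_gauge d)[r1 r10 k1P]] := locQ (y t).
  have [k2 /(nbhs_gauge d)[r2 r20 k2P]] := locQ p.
  have r0 : 0 < Num.min r1 r2 / 2 by rewrite divr_gt0// lt_min r10.
  have [r r_gt0 [rP lP]] := sides _ r0; have [n nr] := invS_lt r0.
  exists r => //; exists (maxn n (maxn k1 k2)) => m u ut.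
  rewrite !geq_max => /and3P[nm k1m k2m] k z mk uz.
  move: ut; rewrite ltr_distl => /andP[u1 u2].
  have uz' := le_gdistW (ltW (nr m nm)) uz.
  have [tu|ut] := leP (val t) (val u).
    apply: k1P (leq_trans k1m mk).
    apply: le_gdistW (le_gdistD (rP u tu u2) uz').
    by rewrite -splitr ge_min lexx.
  apply: k2P (leq_trans k2m mk).
  apply: le_gdistW (le_gdistD (lP u u1 ut) uz').
  by rewrite -splitr ge_min lexx orbT.
have q0 : 0 < (n.+1%:R^-1 : R) by rewrite invr_gt0 ltr0n.
exists n; apply/nbhs_ballP; exists (n.+1%:R^-1) => // b /ball_sym.
rewrite (ball_gdist dX) /dist_ball /= (gdist_pathE S) => ba k nk t.
have [l [_ _ dl]] := skorohod_dist_ltP ba.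
by apply: (nP (l t)) nk _; exact: le_gdistC.
Qed.

(** The values of b at times converging to t may converge to b(t) or to its left
    limit, so the comparison is made at times to the right of t, where
    right-continuity applies. *)
Lemma skorohod_hausdorff :
  (forall a b : T, (forall r, 0 < r -> (d a b <= r%:E)%E) -> a = b) ->
  forall a b : X, (forall r, 0 < r -> (dX a b <= r%:E)%E) -> a = b.
Proof.
move=> sepT a b ab; apply: (path_inj (s := S)); apply/funext => t; apply: sepT => e e0.
have e30 : 0 < e / 3 by rewrite divr_gt0.
have [_ /(_ _ e30)[r1 r10 [aP _]]] := cadlag_sides d t (path_cadlag S a).
have [_ /(_ _ e30)[r2 r20 [bP _]]] := cadlag_sides d t (path_cadlag S b).
have e3e : e / 3 <= e by rewrite ler_pdivrMr// ler_peMr ?ler1n// ltW.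
have near_l eta : 0 < eta -> exists l, [/\ time_change l, (dev_norm l <= eta%:E)%E &
    forall u, (d (path_of S a u) (path_of S b (l u)) <= (e / 3)%:E)%E].
  move=> eta0; have [c c0 cP] := dev_le_cost S eta0.
  have m0 : 0 < Num.min c (e / 3) by rewrite lt_min c0.
  have m20 : 0 < Num.min c (e / 3) / 2 by rewrite divr_gt0.
  have : (dX a b < (Num.min c (e / 3))%:E)%E.
    by apply: le_lt_trans (ab _ m20) _; rewrite lte_fin ltr_pdivrMr// ltr_pMr// ltr1n.
  rewrite (gdist_pathE S) => /skorohod_dist_ltP[l [tl cl dl]]; exists l; split => //.
    by apply: cP => //; apply: le_trans cl _; rewrite lee_fin ge_min lexx.
  by move=> u; apply: le_gdistW (dl u); rewrite ge_min lexx orbT.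
have [t1|t1] := ltP (val t) 1; last first.
  have -> : t = I1 R by apply: val_inj; apply/le_anti; rewrite t1 I01_le1.
  have [l [tl _ dl]] := near_l 1 ltr01.
  by have := dl (I1 R); rewrite time_change1//; exact: le_gdistW.
(* Compare a and b at a point u slightly to the right of t, moved so little by the
   time change that its image is still to the right of t. *)
pose eta := Num.min (Num.min r1 r2) (1 - val t) / 4.
have eta0 : 0 < eta by rewrite divr_gt0// !lt_min r10 r20 subr_gt0.
have e1 : 4 * eta <= r1 by rewrite mulrC divfK// !ge_min lexx.
have e2 : 4 * eta <= r2 by rewrite mulrC divfK// !ge_min lexx orbT.
have e3 : 4 * eta <= 1 - val t by rewrite mulrC divfK// ge_min lexx orbT.
have [l [tl /dev_norm_leP ldev dl]] := near_l eta eta0.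
have uK : val (toI (val t + 2 * eta) : I01 R) = val t + 2 * eta.
  by rewrite toIK//; apply/andP; split; have := I01_ge0 t; lra.
set u : I01 R := toI _ in uK.
have := ldev u; rewrite uK ler_norml => /andP[lo up].
have h1 : (d (path_of S a t) (path_of S a u) <= (e / 3)%:E)%E.
  by apply: aP; rewrite uK; lra.
have h2 : (d (path_of S b t) (path_of S b (l u)) <= (e / 3)%:E)%E.
  by apply: bP; lra.
apply: le_gdistW (le_gdistD (le_gdistD h1 (dl u)) (le_gdistC h2)).
lra.
Qed.

End skorohod_space_theory.

Lemma gauge_hausdorff (R : realType) (X : pseudoMetricType R) (d : gauge X) :
  (forall a b : X, (forall r : R, 0 < r -> (d a b <= r%:E)%E) -> a = b) ->
  hausdorff_space X.
Proof.
move=> sep a b clab; apply: sep => r r0; have r20 : 0 < r / 2 by rewrite divr_gt0.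
have [c []] := clab _ _ (nbhsx_ballx a _ r20) (nbhsx_ballx b _ r20).
rewrite !(ball_gdist d) /dist_ball /= => /ltW ac /ltW bc.
by rewrite (splitr r); exact: le_gdistD ac (le_gdistC bc).
Qed.

Section instances.
Variable R : realType.

Lemma dev_norm_le_log (e : R) : 0 < e -> exists2 c : R, 0 < c &
  forall l, time_change l -> (log_norm l <= c%:E)%E -> (dev_norm l <= e%:E)%E.
Proof.
move=> e0; have e1 : 1 < 1 + e by rewrite ltrDl.
exists (ln (1 + e)) => [|l tl ll]; first exact: ln_gt0.
apply: le_trans (dev_norm_log_norm tl ll) _.
by rewrite lnK ?posrE ?(lt_trans ltr01)// addrC addKr.
Qed.

Definition J1_space : skorohod_space (abs_gauge R) (J1_gauge R).
Proof.
apply: (@SkorohodSpace R R _ (skoD R) _ (@skoD_fun R) _ _ _ (@log_norm R)).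
- by move=> a; exact: set_valP a.
- by move=> x cx; exists (exist _ x (mem_set cx)).
- by move=> a b ab; apply: val_inj.
- by [].
- by move=> e e0; exists e.
- exact: dev_norm_le_log.
Defined.

Definition DD_space : skorohod_space (J1_gauge R) (DD_gauge R).
Proof.
apply: (@SkorohodSpace R (skoD R) _ (skoDD R) _ (@skoDD_fun R) _ _ _ (@dev_norm R)).
- by move=> a; exact: set_valP a.
- by move=> x cx; exists (exist _ x (mem_set cx)).
- by move=> a b ab; apply: val_inj.
- by [].
- exact: dev_norm_le_log.
- by move=> e e0; exists e.
Defined.

Lemma skoD_separated (a b : skoD R) :
  (forall r : R, 0 < r -> (J1_gauge R a b <= r%:E)%E) -> a = b.
Proof.
apply: (skorohod_hausdorff J1_space) => x y xy; apply/eqP; rewrite -subr_eq0 -normr_le0.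
by apply/ler_addgt0Pr => r /xy; rewrite add0r /= /abs_dist lee_fin.
Qed.

Lemma skoDD_hausdorff : hausdorff_space (skoDD R).
Proof.
apply: (gauge_hausdorff (d := DD_gauge R)).
exact: (skorohod_hausdorff DD_space skoD_separated).
Qed.

End instances.

(** * Tameness and the moduli of the theorem *)

Section moduli.
Variables (R : realType) (T : pseudoMetricType R) (d : gauge T).
Implicit Types (x : I01 R -> T) (e delta : R).

Lemma tame_modulus2 x e delta : tame d e delta x -> (modulus2 d x delta <= e%:E)%E.
Proof.
move=> [x1 _ _]; apply: ge_ereal_sup => _ [s1 [s [s2 [s1s ss2 s21 ->]]]].
by rewrite ge_min; case: (x1 s1 s s2 s1s ss2 s21) => ->; rewrite ?orbT.
Qed.

Lemma tame_origin x e delta : tame d e delta x -> 0 <= delta <= 1 ->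
  (d (x (toI delta)) (x (I0 R)) <= e%:E)%E.
Proof. by move=> [_ x2 _] d01; apply: x2; rewrite toIK. Qed.

Lemma left_limP x p e : x @ at_leftI (I1 R) --> p -> 0 < e ->
  exists2 r, 0 < r & forall u, 1 - r < val u -> val u < 1 -> (d p (x u) <= e%:E)%E.
Proof.
move=> xp e0; have /at_leftIP[r r0 rP] : at_leftI (I1 R) (x @^-1` ball p e).
  by apply: xp; exact: nbhsx_ballx.
exists r => // u ru u1; have := rP u ru u1.
by rewrite /= (ball_gdist d) /dist_ball /= => /ltW.
Qed.

Lemma left_lim_close x p e s : x @ at_leftI (I1 R) --> p -> val s < 1 ->
  (forall u, val s <= val u -> val u < 1 -> (d (x s) (x u) <= e%:E)%E) ->
  (d p (x s) <= e%:E)%E.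
Proof.
move=> xp s1 sx; apply: le_gdist_lim => r r0; have [q q0 qP] := left_limP xp r0.
pose b := Num.max (val s) (1 - q / 2).
have b1 : b < 1 by rewrite gt_max s1 /=; move: q0; clear; lra.
have sb : val s <= b by rewrite le_max lexx.
have qb : 1 - q < b by rewrite lt_max; apply/orP; right; move: q0; clear; lra.
have bK : val (toI b : I01 R) = b by rewrite toIK// (ltW b1) (le_trans (I01_ge0 s)).
rewrite addrC; apply: le_gdistD (qP (toI b) _ _) _; rewrite ?bK//.
by apply: le_gdistC; apply: sx; rewrite bK.
Qed.

Lemma tame_end x p e delta : tame d e delta x -> 0 < delta <= 1 ->
  x @ at_leftI (I1 R) --> p -> (d p (x (toI (1 - delta))) <= e%:E)%E.
Proof.
move=> [_ _ x3] /andP[d0 d1] xp.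
have dK : val (toI (1 - delta) : I01 R) = 1 - delta.
  by rewrite toIK// subr_ge0 d1 gerBl ltW.
have lt1 : 1 - delta < 1 by rewrite gtrBl.
by apply: (left_lim_close xp); rewrite dK// => u du u1; apply: x3; rewrite ?dK.
Qed.

(** The three-point condition for 0, s, delta, together with the bound at
    delta, controls x on the whole of [0, delta]; the same holds near 1, with the
    triple 1 - delta, s, u where u tends to 1. *)
Lemma modulus2_tame x p e delta : 0 < delta < 1 -> x @ at_leftI (I1 R) --> p ->
  (modulus2 d x delta < e%:E)%E -> (d (x (toI delta)) (x (I0 R)) < e%:E)%E ->
  (d p (x (toI (1 - delta))) < e%:E)%E -> tame d (4 * e) delta x.
Proof.
move=> /andP[d0 d1] xp xm /ltW x0 /ltW x1.
have three (s1 s s2 : I01 R) : val s1 <= val s -> val s <= val s2 ->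
    val s2 - val s1 <= delta -> (d (x s) (x s1) <= e%:E)%E \/ (d (x s2) (x s) <= e%:E)%E.
  move=> s1s ss2 s21; have : (Order.min (d (x s) (x s1)) (d (x s2) (x s)) <= e%:E)%E.
    apply: le_trans (ltW xm); apply: ereal_sup_ubound.
    by exists s1, s, s2.
  by rewrite ge_min => /orP.
have e0 : 0 <= e.
  have [||| |] := three (I0 R) (I0 R) (I0 R); rewrite ?lexx// ?subrr ?(ltW d0)//.
    by rewrite gdistxx lee_fin.
  by rewrite gdistxx lee_fin.
have e14 : e <= 4 * e by rewrite ler_peMl ?ler1n.
have e24 : e + e <= 4 * e by move: e0; clear; lra.
have e44 : (e + e) + (e + e) <= 4 * e by clear; lra.
have dK : val (toI delta : I01 R) = delta by rewrite toIK// !ltW.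
have dK' : val (toI (1 - delta) : I01 R) = 1 - delta.
  by rewrite toIK// subr_ge0 gerBl !ltW.
split.
- by move=> s1 s s2 s1s ss2 s21; have [||| /(le_gdistW e14)|/(le_gdistW e14)] := three s1 s s2;
    rewrite ?s21//; tauto.
- move=> s sd; have [|||s0|ds] := three (I0 R) s (toI delta).
  + by rewrite val_I0 I01_ge0.
  + by rewrite dK.
  + by rewrite dK val_I0 subr0.
  + exact: le_gdistW e14 s0.
  + exact: le_gdistW e24 (le_gdistD (le_gdistC ds) x0).
- have end_p (s : I01 R) : 1 - delta <= val s -> val s < 1 -> (d (x s) p <= (e + e)%:E)%E.
    move=> ds s1; have [sd|nsd] := pselect (d (x s) (x (toI (1 - delta))) <= e%:E)%E.
      exact: le_gdistD sd (le_gdistC x1).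
    apply: le_gdistC; apply: (@le_gdistW _ _ _ _ _ e); first by rewrite lerDl.
    apply: (left_lim_close xp s1) => u su u1.
    have [||| //|] := three (toI (1 - delta)) s u; rewrite ?dK'//.
      by move: u1; clear; lra.
    exact: le_gdistC.
  move=> s s' ds s1 ds' s'1.
  exact: le_gdistW e44 (le_gdistD (end_p s ds s1) (le_gdistC (end_p s' ds' s'1))).
Qed.

End moduli.

(** * Probabilities of local events *)

Section probability_of_events.
Variable R : realType.
Implicit Types (P : probability (borelDD R) R) (A B : set (skoDD R)) (Q : nat -> set (skoDD R)).
Local Open Scope ereal_scope.

Lemma Pr_ge0 P A : 0 <= Pr P A.
Proof. by apply: mu_ext_ge0 => B; exact: measure_ge0. Qed.

Lemma le_Pr P A B : A `<=` B -> Pr P A <= Pr P B.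
Proof. by move=> AB; exact: le_mu_ext. Qed.

Lemma Pr_setU P A B : Pr P (A `|` B) <= Pr P A + Pr P B.
Proof. exact: (outer_measureU2 (mu_ext P)). Qed.

Lemma Pr_bigcup P (A : nat -> set (skoDD R)) :
  Pr P (\bigcup_n A n) <= \sum_(n <oo) Pr P (A n).
Proof. by apply: mu_ext_sigma_subadditive => B; exact: measure_ge0. Qed.

Lemma open_measurableDD A : open A -> measurable (A : set (borelDD R)).
Proof. by move=> oA; exact: sub_sigma_algebra. Qed.

Lemma closed_measurableDD A : closed A -> measurable (A : set (borelDD R)).
Proof.
move=> cA; rewrite -(setCK A); apply: measurableC; apply: open_measurableDD.
exact: closed_openC.
Qed.

Lemma PrE P A : measurable (A : set (borelDD R)) -> Pr P A = P A.
Proof. exact: measurable_mu_extE. Qed.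

Lemma compact_eventually Q (K : set (skoDD R)) : locally_eventually Q -> compact K ->
  exists k0, forall k, (k0 <= k)%N -> K `<=` Q k.
Proof.
move=> locQ /compact_near_coveringP cov.
have : \forall k \near \oo, K `<=` (fun x => forall k', (k <= k')%N -> Q k' x).
  apply: cov => x _; have [k0 xk0] := locQ x.
  exists ([set y | forall k, (k0 <= k)%N -> Q k y], [set k | (k0 <= k)%N]) => /=.
    by split => //; exact: nbhs_infty_ge.
  by move=> [y k] /= [yQ k0k] k' kk'; apply: yQ; exact: leq_trans kk'.
by move=> /filter_ex[k0 Kk0]; exists k0 => k k0k x /Kk0; exact.
Qed.

(** Outer measure is not continuous from above, but the sets where Q k' holds
    for all k' >= k have interiors that increase to the whole space, and continuity
    from above applies to the complements of these open sets. *)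
Lemma Pr_eventually P Q (eta : R) : locally_eventually Q -> (0 < eta)%R ->
  exists k0, forall k, (k0 <= k)%N -> Pr P (~` Q k) <= eta%:E.
Proof.
move=> locQ eta0.
pose O k := interior [set x | forall k', (k <= k')%N -> Q k' x].
have mO k : measurable (~` O k : set (borelDD R)).
  by apply: measurableC; apply: open_measurableDD; exact: open_interior.
have capO : \bigcap_k (~` O k) = set0.
  by apply/seteqP; split => // x xO; have [k0 xk0] := locQ x; exact: (xO k0).
have cv : P (~` O k) @[k --> \oo] --> P (\bigcap_k (~` O k)).
  apply: (@nonincreasing_cvg_mu _ (borelDD R) R P (fun k => ~` O k)) => //.
  - by apply: le_lt_trans (probability_le1 P (mO 0%N)) _; rewrite ltry.
  - by rewrite capO; exact: measurable0.
  - move=> k k' kk'; apply/subsetPset; apply: subsetC.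
    by apply: interiorS => x xQ k'' k'k''; apply: xQ; exact: leq_trans k'k''.
rewrite capO measure0 in cv.
have nb : nbhs (0 : \bar R) [set y | y < eta%:E] by apply: open_ereal_lt'; rewrite lte_fin.
have [k0 _ k0P] := cv _ nb.
exists k0 => k k0k; apply: le_trans (ltW (k0P k k0k)); rewrite -PrE//.
apply: le_Pr; apply: subsetC => x /interior_subset; apply; exact: leqnn.
Qed.

(** The finitely many n that an upper limit ignores are handled one at a time;
    monotonicity allows passing to a common index. *)
Lemma Pr_uniformly (P : nat -> probability (borelDD R) R) Q (eta : R) :
  locally_eventually Q -> (forall k k', (k <= k')%N -> Q k `<=` Q k') -> (0 < eta)%R ->
  (exists k N, forall n, (N <= n)%N -> Pr (P n) (~` Q k) <= eta%:E) ->
  exists k, forall n, Pr (P n) (~` Q k) <= eta%:E.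
Proof.
move=> locQ Qmono eta0 [k [N kN]].
have [k' k'N] : exists k', forall n, (n < N)%N -> Pr (P n) (~` Q k') <= eta%:E.
  elim: N {kN} => [|N [k' k'N]]; first by exists 0%N.
  have [k0 k0P] := Pr_eventually (P N) locQ eta0.
  exists (maxn k' k0) => n; rewrite ltnS leq_eqVlt => /orP[/eqP ->|nN].
    by apply: k0P; exact: leq_maxr.
  apply: le_trans (k'N n nN); apply: le_Pr; apply: subsetC; apply: Qmono; exact: leq_maxl.
exists (maxn k k') => n; have [Nn|nN] := leqP N n.
  apply: le_trans (kN n Nn); apply: le_Pr; apply: subsetC; apply: Qmono; exact: leq_maxl.
apply: le_trans (k'N n nN); apply: le_Pr; apply: subsetC; apply: Qmono; exact: leq_maxr.
Qed.

Lemma limn_esup_lt (u : nat -> \bar R) (c : \bar R) : limn_esup u < c ->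
  exists N, forall n, (N <= n)%N -> u n < c.
Proof.
rewrite /limn_esup limf_esupE => /ereal_inf_lt[_ [V [N _ NV] <-] Vc].
exists N => n Nn; apply: le_lt_trans Vc; apply: ereal_sup_ubound.
by exists n => //; exact: NV.
Qed.

Lemma limn_esup_le (u : nat -> \bar R) (c : \bar R) : (forall n, u n <= c) -> limn_esup u <= c.
Proof.
move=> uc; rewrite /limn_esup limf_esupE; apply: ge_ereal_inf.
exists (ereal_sup (u @` setT)); first by exists setT => //; exact: filterT.
by apply: ge_ereal_sup => _ [n _ <-].
Qed.

Lemma cvg_limsup_Pr (P : nat -> probability (borelDD R) R) (F : set_system R)
    (B : R -> set (skoDD R)) :
  Filter F ->
  (forall eta : R, (0 < eta)%R -> \forall r \near F, forall n, Pr (P n) (B r) <= eta%:E) ->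
  limn_esup (fun n => Pr (P n) (B r)) @[r --> F] --> 0.
Proof.
move=> FF small; have ge0 r : 0 <= limn_esup (fun n => Pr (P n) (B r)).
  apply: limf_esup_ge0 => [|n]; last exact: Pr_ge0.
  by have [//] : ProperFilter (\oo : set_system nat) by exact: eventually_filter.
apply/fine_cvgP; split.
  apply: filterS (small 1%R ltr01) => r /limn_esup_le rle.
  by rewrite ge0_fin_numE// (le_lt_trans rle)// ltry.
apply/cvgrPdist_le => eta eta0; apply: filterS (small eta eta0) => r /limn_esup_le rle.
rewrite /= sub0r normrN ger0_norm ?fine_ge0// -lee_fin fineK// ge0_fin_numE//.
by rewrite (le_lt_trans rle)// ltry.
Qed.

Lemma limsup_Pr_lt (P : nat -> probability (borelDD R) R) (F : set_system R)
    {FF : Filter F} (B : R -> set (skoDD R)) (eta : R) : (0 < eta)%R ->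
  limn_esup (fun n => Pr (P n) (B r)) @[r --> F] --> 0 ->
  \forall r \near F, exists N, forall n, (N <= n)%N -> Pr (P n) (B r) <= eta%:E.
Proof.
move=> eta0 cv.
have nb : nbhs (0 : \bar R) [set y | y < eta%:E] by apply: open_ereal_lt'; rewrite lte_fin.
apply: (filterS (F := F) _ (cv _ nb)) => r /limn_esup_lt[N NP]; exists N => n Nn; exact/ltW/NP.
Qed.

End probability_of_events.

(** * Tightness *)

Lemma locally_eventually_and (X : topologicalType) (Q Q' : nat -> set X) :
  locally_eventually Q -> locally_eventually Q' ->
  locally_eventually (fun k x => Q k x /\ Q' k x).
Proof.
move=> lQ lQ' x; have [k xk] := lQ x; have [k' xk'] := lQ' x.
exists (maxn k k'); apply: filterS (filterI xk xk') => y [yk yk'] m.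
by rewrite geq_max => /andP[km k'm]; split; [exact: yk|exact: yk'].
Qed.

Lemma cadlag_left_lim (R : realType) (T : ptopologicalType) (x : I01 R -> T) :
  cadlag x -> x @ at_leftI (I1 R) --> left_lim x (I1 R).
Proof. by move=> [_ xl]; have [l /cvgP] := xl (I1 R) ltr01. Qed.

Section good_paths.
Variable R : realType.
Implicit Types (x : skoDD R) (e : R).

Definition bounded_by (k : nat) x := forall t s, `|x t s| <= k%:R.

Definition inner_tame e (k : nat) x :=
  forall t, tame (abs_gauge R) e (k.+1%:R^-1) (x t : I01 R -> R).

Definition outer_tame e (k : nat) x :=
  tame (J1_gauge R) e (k.+1%:R^-1) (x : I01 R -> skoD R).

(** The three groups of conditions of the theorem, with scale 1/(k+1) and norm
    bound k tied to the same index. *)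
Definition good e (k : nat) x := (bounded_by k x /\ inner_tame e k x) /\ outer_tame e k x.

(** Boundedness is local on the real line, and passes to the inner and
    then to the outer paths. *)
Lemma locally_bounded : locally_eventually bounded_by.
Proof.
apply: (locally_path (DD_space R) (Q := fun k (z : skoD R) => forall s, `|z s| <= k%:R)).
apply: (locally_path (J1_space R) (Q := fun k (z : R) => `|z| <= k%:R)) => z.
have [k zk] : exists k, `|z| + 1 <= k%:R.
  by exists (Num.bound (`|z| + 1)); apply/ltW/archi_boundP; rewrite addr_ge0.
exists k; apply/nbhs_ballP; exists 1 => //= w; rewrite /ball /= => zw m km.
apply: le_trans (_ : k%:R <= _); last by rewrite ler_nat.
by apply: le_trans zk; rewrite -lerBlDl; apply: le_trans (lerB_dist _ _) _; rewrite distrC ltW.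
Qed.

Lemma locally_inner_tame e : 0 < e -> locally_eventually (inner_tame e).
Proof.
move=> e0; apply: (locally_path (DD_space R) (Q := fun k (z : skoD R) =>
  tame (abs_gauge R) e (k.+1%:R^-1) (z : I01 R -> R))).
exact: (locally_tame (J1_space R)).
Qed.

Lemma locally_outer_tame e : 0 < e -> locally_eventually (outer_tame e).
Proof. by move=> e0; exact: (locally_tame (DD_space R)). Qed.

Lemma locally_good e : 0 < e -> locally_eventually (good e).
Proof.
move=> e0; apply: locally_eventually_and; last exact: locally_outer_tame.
by apply: locally_eventually_and; [exact: locally_bounded|exact: locally_inner_tame].
Qed.

Lemma invS_le (k k' : nat) : (k <= k')%N -> (k'.+1%:R^-1 : R) <= k.+1%:R^-1.
Proof. by move=> kk'; rewrite lef_pV2 ?posrE ?ltr0n// ler_nat. Qed.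

Lemma good_mono e k k' : (k <= k')%N -> good e k `<=` good e k'.
Proof.
move=> kk' x [[xb xi] xo]; split; [split|].
- by move=> t s; apply: le_trans (xb t s) _; rewrite ler_nat.
- by move=> t; apply: tame_le (xi t) => //; exact: invS_le.
- by apply: tame_le xo => //; exact: invS_le.
Qed.

Lemma DD_norm_le x (c : R) : (forall t s, `|x t s| <= c) -> (DD_norm x <= c%:E)%E.
Proof.
move=> xc; apply: ge_ereal_sup => _ [t _ <-]; apply: ge_ereal_sup => _ [s _ <-].
by rewrite lee_fin.
Qed.

Lemma DD_norm_ub x t s : ((`|x t s|%R)%:E <= DD_norm x)%E.
Proof.
apply: le_trans (_ : sup_norm (x t) <= _)%E; first exact: sup_norm_ub.
by apply: ereal_sup_ubound; exists t.
Qed.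

(** The criterion is applied first in the inner space, to the set of values
    of the paths, and then in the outer space with the compact set so obtained. *)
Lemma compact_closure_good (e : nat -> R) (k : nat -> nat) :
  (forall r, 0 < r -> exists m, e m <= r) ->
  compact (closure [set x : skoDD R | forall m, good (e m) (k m) x]).
Proof.
move=> e_small; pose q m : R := (k m).+1%:R^-1.
have q0 m : 0 < q m by rewrite invr_gt0 ltr0n.
pose K1 := [set z : skoD R | (forall s, `|z s| <= (k 0%N)%:R) /\
  forall m, tame (abs_gauge R) (e m) (q m) (z : I01 R -> R)].
have cK1 : compact (closure K1).
  apply: (compact_closure_tame (S := J1_space R) (@segment_compact R (- (k 0%N)%:R) (k 0%N)%:R)).
    by move=> z t [zk _]; rewrite /= in_itv /= -ler_norml; exact: zk.
  move=> r r0; have [m mr] := e_small r r0; exists (q m) => // z [_ zt].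
  exact: tame_le mr _ (zt m).
apply: (compact_closure_tame (S := DD_space R) cK1).
  move=> x t xg; apply: subset_closure; split => [s|m].
    by have [[xb _] _] := xg 0%N; exact: xb.
  by have [[_ xi] _] := xg m; exact: xi.
move=> r r0; have [m mr] := e_small r r0; exists (q m) => // x xg.
by have [_ xo] := xg m; exact: tame_le mr _ xo.
Qed.

End good_paths.

Section from_tightness.
Variables (R : realType) (P : nat -> probability (borelDD R) R).
Hypothesis tP : tight (range P).

(** On the compact set that carries all P n up to eta, Q k holds for some k, so
    the events B r are contained in its complement for r close to the limit. *)
Lemma tight_limsup (F : set_system R) (Q : nat -> set (skoDD R)) (B : R -> set (skoDD R)) :
  Filter F -> locally_eventually Q ->
  (forall k, \forall r \near F, forall x, Q k x -> B r x -> False) ->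
  limn_esup (fun n => Pr (P n) (B r)) @[r --> F] --> 0%E.
Proof.
move=> FF locQ QB; apply: cvg_limsup_Pr => eta eta0.
have [K cK PK] := tP eta0; have [k kK] := compact_eventually locQ cK.
have mK : measurable (K : set (borelDD R)).
  by apply: closed_measurableDD; apply: compact_closed cK; exact: skoDD_hausdorff.
apply: filterS (QB k) => r rB n.
apply: (@le_trans _ _ (Pr (P n) (~` K))).
  by apply: le_Pr => x xB Kx; apply: rB xB; exact: kK Kx.
rewrite PrE; last exact: measurableC.
rewrite probability_setC//; have := PK (P n) (imageP _ Logic.I).
rewrite -[P n K]fineK ?fin_num_measure// -EFinB !lee_fin; lra.
Qed.

End from_tightness.

Lemma near0_invS (R : realType) (k : nat) :
  \forall delta \near (0 : R)^'+, 0 < delta <= k.+1%:R^-1.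
Proof.
near=> delta; apply/andP; split; first by near: delta; exact: nbhs_right_gt.
by near: delta; apply: nbhs_right_le; rewrite invr_gt0 ltr0n.
Unshelve. all: by end_near. Qed.

Lemma invS_le1 (R : realType) (k : nat) : (k.+1%:R^-1 : R) <= 1.
Proof. by rewrite invf_le1 ?ltr0n// ler1n. Qed.

Lemma invS_at_right (R : realType) (A : set R) : (0 : R)^'+ A ->
  \forall k \near \oo, A (k.+1%:R^-1).
Proof.
move=> /nbhs_ballP[r /= r0 rA]; have [n nr] := invS_lt r0.
exists n => // k /= nk; have k0 : 0 < (k.+1%:R^-1 : R) by rewrite invr_gt0 ltr0n.
by apply: rA => //; rewrite /ball /= sub0r normrN ger0_norm ?(ltW k0)// nr.
Qed.

Lemma nat_pinfty (R : realType) (A : set R) : (+oo : set_system R) A ->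
  \forall k \near \oo, A k%:R.
Proof.
move=> [M [_ MA]]; exists (Num.bound `|M|) => // k /= Mk; apply: MA.
apply: le_lt_trans (ler_norm M) _; apply: lt_le_trans (archi_boundP (normr_ge0 M)) _.
by rewrite ler_nat.
Qed.

Section to_tightness.
Variables (R : realType) (P : nat -> probability (borelDD R) R).
Local Open Scope ereal_scope.

Lemma le_PrU (Q : probability (borelDD R) R) (A B : set (skoDD R)) (a b : R) :
  Pr Q A <= a%:E -> Pr Q B <= b%:E -> Pr Q (A `|` B) <= (a + b)%:E.
Proof. by move=> Aa Bb; rewrite EFinD; apply: le_trans (Pr_setU _ _ _) _; exact: leeD. Qed.

(** Level 1/(m+1) is satisfied with an error of eta / 2^(m+1), and the errors
    sum up to eta. The compact set is the closure of the intersection, whose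
    complement is open and thus has a probability equal to its outer measure. *)
Lemma tight_of_good :
  (forall e eta : R, (0 < e)%R -> (0 < eta)%R ->
    exists k N, forall n, (N <= n)%N -> Pr (P n) (~` good e k) <= eta%:E) ->
  tight (range P).
Proof.
move=> small eta eta0.
have /choice[k kP] m : exists k, forall n,
    Pr (P n) (~` good (m.+1%:R^-1 : R) k) <= (eta / (2 ^ m.+1)%:R)%:E.
  have e0 : (0 < m.+1%:R^-1 :> R)%R by rewrite invr_gt0 ltr0n.
  have eta'0 : (0 < eta / (2 ^ m.+1)%:R)%R by rewrite divr_gt0// ltr0n expn_gt0.
  apply: Pr_uniformly (small _ _ e0 eta'0) => //; first exact: locally_good.
  by move=> k k'; exact: good_mono.
set A := [set x : skoDD R | forall m, good (m.+1%:R^-1 : R) (k m) x].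
exists (closure A).
  by apply: compact_closure_good => r r0; have [n nr] := invS_lt r0; exists n; exact/ltW/nr.
move=> _ [n _ <-]; have cA : closed (closure A) by exact: closed_closure.
have mA := closed_measurableDD cA.
have : Pr (P n) (~` closure A) <= eta%:E.
  apply: (@le_trans _ _ (Pr (P n) (\bigcup_m ~` good (m.+1%:R^-1 : R) (k m)))).
    apply: le_Pr => x nAx; apply: contrapT => nbad; apply: nAx; apply: subset_closure => m.
    by apply: contrapT => nm; apply: nbad; exists m.
  apply: le_trans (Pr_bigcup _ _) _.
  apply: (@le_trans _ _ (\sum_(m <oo) (0 + (eta / (2 ^ m.+1)%:R)%:E))).
    apply: lee_nneseries => [m _ _|m _]; first exact: Pr_ge0.
    by rewrite add0e; exact: kP.
  apply: le_trans (epsilon_trick xpredT _ (ltW eta0)) _ => //.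
  by rewrite eseries0// add0e.
rewrite PrE; last exact: measurableC.
rewrite probability_setC// -[P n (closure A)]fineK ?fin_num_measure// -EFinB !lee_fin.
by move=> h; lra.
Qed.

End to_tightness.

Unset Implicit Arguments.
Local Open Scope ereal_scope.

Theorem theorem3p8 (R : realType) (P : nat -> probability (borelDD R) R) :
  tight (range P) <->
  [/\ limn_esup (fun n => Pr (P n) [set x : skoDD R | a%:E <= DD_norm x])
        @[a --> +oo%R] --> 0,
      (forall eps : R, (0 < eps)%R ->
        [/\ limn_esup (fun n => Pr (P n) [set x : skoDD R | exists t : I01 R,
                eps%:E <= w2 (x t) delta])
              @[delta --> 0%R^'+] --> 0,
            limn_esup (fun n => Pr (P n) [set x : skoDD R | exists t : I01 R,
                (eps <= `|x t (toI delta) - x t (I0 R)|)%R])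
              @[delta --> 0%R^'+] --> 0 &
            limn_esup (fun n => Pr (P n) [set x : skoDD R | exists t : I01 R,
                (eps <= `|(left_lim (x t) (I1 R) : R) -
                          x t (toI (1 - delta))|)%R])
              @[delta --> 0%R^'+] --> 0]) &
      (forall eps : R, (0 < eps)%R ->
        [/\ limn_esup (fun n => Pr (P n) [set x : skoDD R |
                eps%:E <= w2DD x delta])
              @[delta --> 0%R^'+] --> 0,
            limn_esup (fun n => Pr (P n) [set x : skoDD R |
                eps%:E <= dJ1 (x (toI delta)) (x (I0 R))])
              @[delta --> 0%R^'+] --> 0 &
            limn_esup (fun n => Pr (P n) [set x : skoDD R |
                eps%:E <= dJ1 (left_lim x (I1 R)) (x (toI (1 - delta)))])
              @[delta --> 0%R^'+] --> 0])].
Proof.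
split=> [tP|[normP innerP outerP]].
  split.
  - refine (@tight_limsup R P tP (pinfty_nbhs R) _
      (fun a => [set x : skoDD R | a%:E <= DD_norm x]) _
      (@locally_bounded R) _) => k; near=> a => x xk ax.
    have : a%:E <= k%:R%:E by apply: le_trans ax _; exact: DD_norm_le.
    rewrite lee_fin leNgt => /negP; apply.
    by near: a; exact: nbhs_pinfty_gt.
  - move=> eps eps0; have e0 : (0 < eps / 2)%R by rewrite divr_gt0.
    have e_lt : (eps / 2 < eps)%R by rewrite ltr_pdivrMr// ltr_pMr// ltr1n.
    have small k (delta : R) x (t : I01 R) : inner_tame (eps / 2) k x ->
        (0 < delta <= k.+1%:R^-1)%R -> tame (abs_gauge R) (eps / 2) delta (x t : I01 R -> R).
      by move=> xt /andP[_ dk]; exact: tame_le (lexx _) dk (xt t).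
    have d1 k (delta : R) : (0 < delta <= k.+1%:R^-1)%R -> (0 < delta <= 1)%R.
      by move=> /andP[-> /le_trans]; apply; exact: invS_le1.
    split; refine (@tight_limsup R P tP (0%R^'+) _ _ _ (locally_inner_tame e0) _) => k;
      apply: filterS (near0_invS R k) => delta dk x xt [t].
    + rewrite leNgt => /negP; apply.
      by apply: le_lt_trans (tame_modulus2 (small _ _ _ t xt dk)) _; rewrite lte_fin.
    + rewrite leNgt => /negP; apply; apply: le_lt_trans e_lt.
      have /andP[d0 dle1] := d1 _ _ dk.
      have := tame_origin (small _ _ _ t xt dk); rewrite (ltW d0) dle1 => /(_ isT).
      by rewrite /= /abs_dist lee_fin.
    + rewrite leNgt => /negP; apply; apply: le_lt_trans e_lt.
      have := tame_end (small _ _ _ t xt dk) (d1 _ _ dk)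
        (cadlag_left_lim (path_cadlag (J1_space R) (x t))).
      by rewrite /= /abs_dist lee_fin.
  - move=> eps eps0; have e0 : (0 < eps / 2)%R by rewrite divr_gt0.
    have e_lt : (eps / 2)%:E < eps%:E by rewrite lte_fin ltr_pdivrMr// ltr_pMr// ltr1n.
    have small k (delta : R) x : outer_tame (eps / 2) k x -> (0 < delta <= k.+1%:R^-1)%R ->
        tame (J1_gauge R) (eps / 2) delta (x : I01 R -> skoD R).
      by move=> xt /andP[_ dk]; exact: tame_le (lexx _) dk xt.
    have d1 k (delta : R) : (0 < delta <= k.+1%:R^-1)%R -> (0 < delta <= 1)%R.
      by move=> /andP[-> /le_trans]; apply; exact: invS_le1.
    split; refine (@tight_limsup R P tP (0%R^'+) _ _ _ (locally_outer_tame e0) _) => k;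
      apply: filterS (near0_invS R k) => delta dk x xt /=.
    + rewrite leNgt => /negP; apply.
      exact: le_lt_trans (tame_modulus2 (small _ _ _ xt dk)) e_lt.
    + rewrite leNgt => /negP; apply; apply: le_lt_trans e_lt.
      have /andP[d0 dle1] := d1 _ _ dk.
      by apply: (tame_origin (small _ _ _ xt dk)); rewrite (ltW d0).
    + rewrite leNgt => /negP; apply; apply: le_lt_trans e_lt.
      exact: (tame_end (small _ _ _ xt dk) (d1 _ _ dk)
        (cadlag_left_lim (path_cadlag (DD_space R) x))).
apply: tight_of_good => e eta e0 eta0.
(* The moduli at e / 4 give tameness at e; the seven bad events share eta. *)
have eps0 : (0 < e / 4)%R by rewrite divr_gt0.
have eta7 : (0 < eta / 7)%R by rewrite divr_gt0.
have [in1 in2 in3] := innerP _ eps0; have [out1 out2 out3] := outerP _ eps0.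
have along0 (B : R -> set (skoDD R)) :
    limn_esup (fun n => Pr (P n) (B delta)) @[delta --> 0%R^'+] --> 0 ->
    exists M, forall k, (M <= k)%N -> exists N, forall n, (N <= n)%N ->
      Pr (P n) (B (k.+1%:R^-1)%R) <= (eta / 7)%:E.
  by move=> /(limsup_Pr_lt eta7) /invS_at_right[M _ MP]; exists M.
have fP : Filter (+oo%R : set_system R) by exact: proper_pinfty_nbhs.
have [M0 _ B0] := nat_pinfty (@limsup_Pr_lt R P _ fP _ _ eta7 normP).
have [M1 B1] := along0 _ in1; have [M2 B2] := along0 _ in2; have [M3 B3] := along0 _ in3.
have [M4 B4] := along0 _ out1; have [M5 B5] := along0 _ out2; have [M6 B6] := along0 _ out3.
have [k] : exists k,
    (maxn 1 (maxn M0 (maxn M1 (maxn M2 (maxn M3 (maxn M4 (maxn M5 M6)))))) <= k)%N.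
  by eexists; exact: leqnn.
rewrite !geq_max => /and4P[kge1 /B0[N0 k0] /B1[N1 k1]].
move=> /and4P[/B2[N2 k2] /B3[N3 k3] /B4[N4 k4] /andP[/B5[N5 k5] /B6[N6 k6]]].
exists k, (maxn N0 (maxn N1 (maxn N2 (maxn N3 (maxn N4 (maxn N5 N6)))))) => n.
rewrite !geq_max => /and4P[/k0 {}k0 /k1 {}k1 /k2 {}k2 /and4P[/k3 {}k3 /k4 {}k4 /k5 {}k5 /k6 {}k6]].
have := le_PrU k0 (le_PrU k1 (le_PrU k2 (le_PrU k3 (le_PrU k4 (le_PrU k5 k6))))).
have -> : (eta / 7 + (eta / 7 + (eta / 7 + (eta / 7 + (eta / 7 + (eta / 7 + eta / 7))))))%R = eta.
  lra.
apply: le_trans; apply: le_Pr => x nx; apply: contrapT => nB; apply: nx.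
have delta01 : (0 < (k.+1%:R^-1 : R) < 1)%R.
  by rewrite invr_gt0 ltr0n invf_lt1 ?ltr0n// ltr1n.
have e4 : (e = 4 * (e / 4))%R by rewrite mulrC divfK.
split; [split|].
- move=> t s; rewrite leNgt; apply/negP => kx; apply: nB; left.
  by apply: le_trans (DD_norm_ub x t s); rewrite lee_fin ltW.
- move=> t; rewrite e4; apply: (modulus2_tame delta01
    (cadlag_left_lim (path_cadlag (J1_space R) (x t)))).
  + by rewrite ltNge; apply/negP => h; apply: nB; right; left; exists t.
  + rewrite ltNge; apply/negP => h; apply: nB; right; right; left; exists t.
    by move: h; rewrite /= /abs_dist lee_fin.
  + rewrite ltNge; apply/negP => h; apply: nB; do 3 right; left; exists t.
    by move: h; rewrite /= /abs_dist lee_fin.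
- rewrite /outer_tame e4; apply: (modulus2_tame delta01
    (cadlag_left_lim (path_cadlag (DD_space R) x))).
  + by rewrite ltNge; apply/negP => h; apply: nB; do 4 right; left.
  + by rewrite ltNge; apply/negP => h; apply: nB; do 5 right; left.
  + by rewrite ltNge; apply/negP => h; apply: nB; do 6 right.
Unshelve. all: by end_near. Qed.
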